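(* Let $\Omega\subset\mathbb{R}^n$ be a bounded domain, let $p\in C^1(\overline{\Omega})$ be a positive function, and let $f$ be a Lipschitz continuous function. Suppose that $u\in C(\overline{\Omega})$ is the viscosity solution in $\Omega$ of $$\sum_{i,j=1}^n u_{x_i}u_{x_j}u_{x_ix_j}+|\nabla u|^2\ln(|\nabla u|)\langle\nabla u,\nabla\ln p\rangle=0$$ and that $v\in C(\overline{\Omega})$ is the viscosity solution in $\Omega$ of $$\sum_{i,j=1}^n v_{x_i}v_{x_j}v_{x_ix_j}=0,$$ both having the same Lipschitz continuous boundary values $f$, i.e. $u=v=f$ on $\partial\Omega$. Then $$\|v-u\|_{L^\infty(\Omega)}\le C_1\|\nabla\ln p\|_{L^\infty(\Omega)}+C_2\|\nabla\ln p\|_{L^\infty(\Omega)}^{1/5}\,\bigl|\ln\bigl(c\,\|\nabla\ln p\|_{L^\infty(\Omega)}\bigr)\bigr|,$$ where the positive constants $C_1,C_2,c$ depend only on $\|f\|_{W^{1,\infty}(\Omega)}$ and $\operatorname{diam}(\Omega)$.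
   Context: The boundary function $f$ is Lipschitz on $\partial\Omega$, $|f(x)-f(y)|\le L|x-y|$, and is regarded as extended to all of $\mathbb{R}^n$ with the same Lipschitz inequality. Write $\Delta_{\infty(x)}\varphi=\sum_{i,j}\varphi_{x_i}\varphi_{x_j}\varphi_{x_ix_j}+|\nabla\varphi|^2\ln(|\nabla\varphi|)\langle\nabla\varphi,\nabla\ln p\rangle$, where the second term is understood to be $0$ at points where $\nabla\varphi=0$ (continuous extension). For constant $p$ this is $\Delta_\infty\varphi=\sum_{i,j}\varphi_{x_i}\varphi_{x_j}\varphi_{x_ix_j}$. A lower semicontinuous function $v:\Omega\to(-\infty,\infty]$ is a viscosity supersolution of $\Delta_{\infty(x)}v=0$ if, whenever $x_0\in\Omega$ and $\varphi\in C^2(\Omega)$ satisfy $\varphi(x_0)=v(x_0)$ and $\varphi(x)<v(x)$ for $x\ne x_0$, we have $\Delta_{\infty(x)}\varphi\le 0$ at $x_0$. A viscosity subsolution is defined similarly: it is upper semicontinuous, test functions touch from above, and the differential inequality is reversed. A viscosity solution is a function that is both a viscosity supersolution and a viscosity subsolution. The viscosity solution with prescribed Lipschitz continuous boundary values is known to be unique. When $\|\nabla\ln p\|_{L^\infty(\Omega)}=0$, the last term of the estimate is read as its limit $0$. *)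

(* Defs.v *)
From HB Require Import structures.
From mathcomp Require Import all_boot all_order all_algebra.
From mathcomp Require Import all_classical all_reals all_analysis.

Set Implicit Arguments.
Unset Strict Implicit.
Unset Printing Implicit Defensive.

Import Order.TTheory GRing.Theory Num.Theory.
Import numFieldNormedType.Exports.

Local Open Scope classical_set_scope.
Local Open Scope ring_scope.

Section Euclidean.
Context {R : realType} {n : nat}.
Implicit Types (x y : 'rV[R]_n) (A : set 'rV[R]_n).

Definition inner x y : R := \sum_(i < n) x 0 i * y 0 i.

(* The library norm `|x| on 'rV[R]_n is the max norm; it induces the same
   topology and the same bounded sets, but lengths, Lipschitz bounds and
   diameters have to be measured with the Euclidean norm. *)
Definition enorm x : R := Num.sqrt (inner x x).

Definition diam A : R := sup [set enorm (x - y) | x in A & y in A].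

Definition frontier A : set 'rV[R]_n := closure A `\` interior A.

Definition lipschitz_with (L : R) (f : 'rV[R]_n -> R) : Prop :=
  forall x y, `|f x - f y| <= L * enorm (x - y).

Definition domain A : Prop := [/\ open A, A !=set0 & connected A].

End Euclidean.

Section EssentialSup.
Context {R : realType} {n : nat}.

Definition box (a b : 'rV[R]_n) : set 'rV[R]_n :=
  [set x | forall i, a 0 i <= x 0 i <= b 0 i].

(* Null sets of the n-dimensional Lebesgue (outer) measure: sets covered by
   countably many boxes of arbitrarily small total volume. *)
Definition lebesgue_null (A : set 'rV[R]_n) : Prop :=
  forall e : R, 0 < e -> exists a b : nat -> 'rV[R]_n,
    [/\ forall k i, a k 0 i <= b k 0 i,
        A `<=` \bigcup_k box (a k) (b k) &
        (\sum_(0 <= k <oo) (\prod_(i < n) (b k 0 i - a k 0 i))%:E <= e%:E)%E].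

Definition Linfty (Omega : set 'rV[R]_n) (g : 'rV[R]_n -> R) : \bar R :=
  ereal_inf [set M%:E | M in
    [set M : R | 0 <= M /\ lebesgue_null [set x | Omega x /\ M < `|g x|]]].

End EssentialSup.

Section Derivatives.
Context {R : realType} {n : nat}.
Implicit Types (f : 'rV[R]_n -> R) (Omega : set 'rV[R]_n).

Definition partial (i : 'I_n) f : 'rV[R]_n -> R :=
  fun x => 'D_(delta_mx 0 i) f x.

Definition grad f (x : 'rV[R]_n) : 'rV[R]_n := \row_i partial i f x.

(* C^k on an open set *)
Fixpoint Ck (k : nat) Omega f : Prop :=
  (forall x, Omega x -> {for x, continuous f}) /\
  if k is k'.+1 then
    forall i : 'I_n, (forall x, Omega x -> derivable f x (delta_mx 0 i)) /\
                     Ck k' Omega (partial i f)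
  else True.

(* C^1 up to the boundary: the partial derivatives in the open set Omega extend
   continuously to the closure. *)
Definition C1_closure Omega f : Prop :=
  [/\ Ck 1 Omega f,
      {within closure Omega, continuous f} &
      forall i : 'I_n, exists2 G : 'rV[R]_n -> R,
        {within closure Omega, continuous G} &
        forall x, Omega x -> G x = partial i f x].

(* W^{1,oo} norm of a Lipschitz function: by Rademacher's theorem the weak
   gradient is the pointwise gradient, which exists outside a null set, so the
   value of grad f elsewhere does not matter. *)
Definition W1infty Omega f : \bar R :=
  (Linfty Omega f + Linfty Omega (fun x => enorm (grad f x)))%E.

End Derivatives.

Section Viscosity.
Context {R : realType} {n : nat}.
Implicit Types (p phi : 'rV[R]_n -> R) (Omega : set 'rV[R]_n).

Definition inf_laplacian phi (x : 'rV[R]_n) : R :=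
  \sum_(i < n) \sum_(j < n)
    partial i phi x * partial j phi x * partial j (partial i phi) x.

(* Where grad phi vanishes, so does the factor enorm (grad phi x) ^+ 2, hence
   the second term is 0 whatever the value of ln 0. *)
Definition infx_laplacian p phi (x : 'rV[R]_n) : R :=
  inf_laplacian phi x +
  enorm (grad phi x) ^+ 2 * ln (enorm (grad phi x)) *
    inner (grad phi x) (grad (fun y => ln (p y)) x).

(* Below, Op phi x is the value at x of the operator applied to phi.
   Semicontinuity is taken in the subspace Omega; values of v outside Omega are
   irrelevant. *)
Definition viscosity_supersolution Omega
    (Op : ('rV[R]_n -> R) -> 'rV[R]_n -> R) (v : 'rV[R]_n -> \bar R) : Prop :=
  [/\ forall x, Omega x -> v x <> -oo%E,
      lower_semicontinuous (v : subspace Omega -> \bar R) &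
      forall x0 phi, Omega x0 -> Ck 2 Omega phi -> (phi x0)%:E = v x0 ->
        (forall x, Omega x -> x <> x0 -> ((phi x)%:E < v x)%E) ->
        Op phi x0 <= 0].

Definition viscosity_subsolution Omega
    (Op : ('rV[R]_n -> R) -> 'rV[R]_n -> R) (v : 'rV[R]_n -> \bar R) : Prop :=
  [/\ forall x, Omega x -> v x <> +oo%E,
      lower_semicontinuous ((fun x => - v x)%E : subspace Omega -> \bar R) &
      forall x0 phi, Omega x0 -> Ck 2 Omega phi -> (phi x0)%:E = v x0 ->
        (forall x, Omega x -> x <> x0 -> (v x < (phi x)%:E)%E) ->
        0 <= Op phi x0].

Definition viscosity_solution Omega
    (Op : ('rV[R]_n -> R) -> 'rV[R]_n -> R) (v : 'rV[R]_n -> R) : Prop :=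
  viscosity_supersolution Omega Op (EFin \o v) /\
  viscosity_subsolution Omega Op (EFin \o v).

End Viscosity.

(* Main.v *)
(* Write h = |grad ln p|. At a point where the gradient has length t the first
   equation reads, after division by t^2, (normalized infinity Laplacian of u)
   = O(h t |ln t|), and t |ln t| <= t^2 + 1. Testing the viscosity inequalities
   only with (smoothed) cones a |x - z| - b |x - z|^2 / 2, b > h (a^2 + 1), gives
   comparison with such cones.

   On a small scale r let U(x) = max_{B_r(x)} u and V(x) = min_{B_r(x)} v, as in
   Armstrong and Smart's proof of Jensen's uniqueness theorem. Then V is
   superharmonic for the finite difference operator max_{B_r} + min_{B_r} - 2,
   and U is subharmonic up to an error b r^2. Where the slope of V is smaller
   than th, V is replaced by an eikonal patch of slope th, at a cost O(th); the
   patched function W is still superharmonic and has slopes at least th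
   everywhere. Finally W - th W^2 is strictly superharmonic, with a gain that
   dominates the error in U when h < th^3 / 34; hence U - (W - th W^2) is almost
   maximal only near the boundary, and r -> 0 gives u - v <= C th.
   The choice th = 4 h^(1/5) yields the estimate for small h (even without the
   logarithm); for large h it follows from the maximum principle. Only the
   bound of f enters, not its Lipschitz constant. *)

Require Import Defs.
From HB Require Import structures.
From mathcomp Require Import all_boot all_order all_algebra.
From mathcomp Require Import all_classical all_reals all_analysis.
From mathcomp Require Import ring lra measurable_realfun.

Set Implicit Arguments.
Unset Strict Implicit.
Unset Printing Implicit Defensive.

Import Order.TTheory GRing.Theory Num.Theory.
Import numFieldNormedType.Exports.

Local Open Scope classical_set_scope.
Local Open Scope ring_scope.

(** * The Euclidean norm *)

Section Euclid.
Context {R : realType} {n : nat}.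
Implicit Types (x y z : 'rV[R]_n).

Lemma innerC x y : inner x y = inner y x.
Proof. by apply: eq_bigr => i _; rewrite mulrC. Qed.

Lemma innerDl x y z : inner (x + y) z = inner x z + inner y z.
Proof. by rewrite -big_split; apply: eq_bigr => i _; rewrite mxE mulrDl. Qed.

Lemma innerZl (a : R) x y : inner (a *: x) y = a * inner x y.
Proof. by rewrite mulr_sumr; apply: eq_bigr => i _; rewrite mxE mulrA. Qed.

Lemma inner_ge0 x : 0 <= inner x x.
Proof. by apply: sumr_ge0 => i _; rewrite -expr2 sqr_ge0. Qed.

Lemma enorm_ge0 x : 0 <= enorm x.
Proof. exact: sqrtr_ge0. Qed.

Lemma enorm2 x : enorm x ^+ 2 = inner x x.
Proof. by rewrite sqr_sqrtr // inner_ge0. Qed.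

Lemma enormZ (a : R) x : enorm (a *: x) = `|a| * enorm x.
Proof.
by rewrite /enorm innerZl innerC innerZl mulrA -expr2 sqrtrM ?sqr_ge0// sqrtr_sqr.
Qed.

Lemma enormN x : enorm (- x) = enorm x.
Proof. by rewrite -scaleN1r enormZ normrN normr1 mul1r. Qed.

Lemma enorm_distC x y : enorm (x - y) = enorm (y - x).
Proof. by rewrite -enormN opprB. Qed.

Lemma enorm0 : enorm (0 : 'rV[R]_n) = 0.
Proof. by rewrite -(scale0r (0 : 'rV[R]_n)) enormZ normr0 mul0r. Qed.

Lemma coord_le_enorm x i : `|x 0 i| <= enorm x.
Proof.
rewrite -(@ler_pXn2r _ 2) ?nnegrE ?normr_ge0 ?enorm_ge0// enorm2 real_normK ?num_real//.
by rewrite /inner (bigD1 i)//= -expr2 lerDl sumr_ge0// => j _; rewrite -expr2 sqr_ge0.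
Qed.

Lemma enorm_eq0 x : enorm x = 0 -> x = 0.
Proof.
move=> x0; apply/rowP => i; rewrite mxE; apply/eqP.
by rewrite -normr_le0 -x0 coord_le_enorm.
Qed.

(** Cauchy-Schwarz: expanding the square norm of |y| x - |x| y leaves the common factor 2 |x| |y|,
    so vanishing norms are treated apart. *)
Lemma inner_le x y : inner x y <= enorm x * enorm y.
Proof.
have [y0|y0] := eqVneq (enorm y) 0.
  by rewrite (enorm_eq0 y0) innerC -(scale0r (0 : 'rV[R]_n)) innerZl enormZ normr0 !mul0r mulr0.
have yp : 0 < enorm y by rewrite lt_neqAle eq_sym y0 enorm_ge0.
have := inner_ge0 (enorm y *: x - enorm x *: y).
rewrite -scaleNr !(innerDl, innerZl) !(innerC _ (_ + _)) !(innerDl, innerZl) -!enorm2 (innerC y x).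
set a := enorm x; set b := enorm y; set c := inner x y => h.
have [a0|a0] := eqVneq a 0.
  have -> : c = 0.
    by rewrite /c (enorm_eq0 a0) -(scale0r (0 : 'rV[R]_n)) innerZl mul0r.
  by rewrite a0 mul0r.
have ap : 0 < a by rewrite lt_neqAle eq_sym a0 enorm_ge0.
have : 0 <= (2 * (a * b)) * (a * b - c) by move: h; congr (_ <= _); ring.
by rewrite pmulr_rge0 ?subr_ge0// mulr_gt0// mulr_gt0.
Qed.

Lemma inner_norm_le x y : `|inner x y| <= enorm x * enorm y.
Proof.
rewrite ler_norml inner_le andbT lerNl -(enormN x).
by rewrite -mulN1r -innerZl scaleN1r inner_le.
Qed.

Lemma enormD x y : enorm (x + y) <= enorm x + enorm y.
Proof.
rewrite -(@ler_pXn2r _ 2) ?nnegrE ?addr_ge0 ?enorm_ge0// enorm2.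
rewrite innerDl !(innerC _ (_ + _)) !innerDl sqrrD !enorm2.
have := inner_le x y; rewrite (innerC y x); lra.
Qed.

Lemma enorm_triangle y x z : enorm (x - z) <= enorm (x - y) + enorm (y - z).
Proof. by rewrite -[x - z](subrKA y) enormD. Qed.

(** Euclidean closeness thus implies closeness in the topology of the max norm; the converse
    direction is [nbhs_enorm]. *)
Lemma mxnorm_le_enorm x : `|x| <= enorm x.
Proof.
change (mx_norm x <= enorm x).
have [->|x0] := eqVneq (mx_norm x) 0; first exact: enorm_ge0.
have [[j i] /= ->] := mx_norm_neq0 x0.
by rewrite ord1 coord_le_enorm.
Qed.

Lemma innerB_continuous z : continuous (fun x => inner (x - z) (x - z)).
Proof.
apply: (@continuous_big R 'I_n +%R 0 xpredT (@add_continuous R) _ _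
  (fun i x => (x - z) 0 i * (x - z) 0 i)) => i _.
have h : continuous (fun x => (x - z) 0 i).
  have -> : (fun x : 'rV[R]_n => (x - z) 0 i) = (fun x => x 0 i - z 0 i).
    by apply/funext => y; rewrite !mxE.
  by move=> x; apply: continuousB; [exact: coord_continuous | exact: cst_continuous].
by move=> x; apply: continuousM; exact: h.
Qed.

Lemma enormB_continuous z : continuous (fun x => enorm (x - z)).
Proof.
move=> x; apply: (@continuous_comp _ _ _ (fun x => inner (x - z) (x - z)) Num.sqrt).
  exact: innerB_continuous.
exact: sqrt_continuous.
Qed.

Lemma nbhs_enorm x (d : R) : 0 < d -> \forall y \near x, enorm (y - x) < d.
Proof.
move=> d0; have h : enorm (y - x) @[y --> x] --> (0 : R).
  by rewrite -enorm0 -(subrr x); exact: enormB_continuous.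
exact: (cvgr_lt 0 h).
Qed.

Lemma within_continuous_enorm (A : set 'rV[R]_n) (u : 'rV[R]_n -> R) x (e : R) :
  {within A, continuous u} -> A x -> 0 < e ->
  exists2 d : R, 0 < d & forall y, A y -> enorm (y - x) < d -> `|u y - u x| < e.
Proof.
move=> /subspace_continuousP uc Ax e0.
have /cvgrPdist_lt/(_ e e0) := uc x Ax.
rewrite /prop_near1 /within /= => /nbhs_ballP[d /= d0 h].
exists d => // y Ay yx; rewrite distrC; apply: (h y) => //.
by rewrite -ball_normE /= distrC (le_lt_trans (mxnorm_le_enorm _)).
Qed.

Lemma compact_unif_continuous (A : set 'rV[R]_n) (u : 'rV[R]_n -> R) (e : R) :
  compact A -> {within A, continuous u} -> 0 < e ->
  exists2 d : R, 0 < d &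
    forall x y, A x -> A y -> enorm (x - y) <= d -> `|u x - u y| <= e.
Proof.
move=> /compact_near_coveringP cA uc e0.
pose P (d : R) x := A x -> forall y, A y -> enorm (x - y) <= d -> `|u x - u y| <= e.
(* Near-covering form of compactness: [P d z] for z near each x of [A] and small d > 0 yields one d
   that serves all of [A]. *)
have : \forall d \near (0 : R)^'+, A `<=` P d.
  apply: cA => x Ax.
  have [r r0 hr] := within_continuous_enorm uc Ax (divr_gt0 e0 (@ltr0n _ 2)).
  have r2 : 0 < r / 2 by rewrite divr_gt0.
  near=> z d => /= Az y Ay zy.
  have zx : enorm (z - x) < r / 2 by near: z; exact: (nbhs_enorm x r2).
  have dr : d < r / 2 by near: d; exact: nbhs_right_lt r2.
  have h1 : `|u z - u x| < e / 2 by apply: hr => //; lra.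
  have h2 : `|u y - u x| < e / 2.
    apply: hr => //; apply: le_lt_trans (enorm_triangle z _ _) _.
    rewrite (enorm_distC y); lra.
  by rewrite (le_trans (ler_distD (u x) _ _))// (distrC (u x)); lra.
rewrite near_withinE => /nbhs_ballP[d /= d0 h].
exists (d / 2); first by rewrite divr_gt0.
move=> x y Ax Ay xy; apply: (h (d / 2) _ _ x Ax Ax y Ay xy).
  by rewrite /ball /= sub0r normrN gtr0_norm; lra.
by rewrite divr_gt0.
Unshelve. all: by end_near. Qed.

Lemma compact_attains_max (A : set 'rV[R]_n) (u : 'rV[R]_n -> R) :
  compact A -> A !=set0 -> {within A, continuous u} ->
  exists2 x, A x & forall y, A y -> u y <= u x.
Proof.
move=> cA A0 /(compact_EVT_max A0 cA)[x /set_mem Ax hx].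
by exists x => // y Ay; apply: hx; rewrite inE.
Qed.
End Euclid.

(** * Radial test functions *)

Section Derivation.
Context {R : realType} {V : normedModType R}.

(** Restriction to the line t |-> t v + x reduces directional derivatives to calculus in one real
    variable. *)
Lemma derive_lineE (f : V -> R) (x v : V) :
  'D_v f x = 'D_1 (fun t : R => f (t *: v + x)) 0.
Proof.
rewrite /derive; set g1 := fun t => t^-1 *: _; set g2 := fun t => t^-1 *: _.
suff -> : g1 = g2 by [].
by apply/funext => t; rewrite /g1 /g2 /= addr0 scale0r add0r [_%:A]mulr1.
Qed.

Lemma is_derive_line (f : V -> R) (x v : V) (df : R) :
  is_derive (0 : R) 1 (fun t : R => f (t *: v + x)) df <-> is_derive x v f df.
Proof.
split=> -[dg <-].
  by split; [exact: (proj2 (derivable1P f x v) dg) | exact: derive_lineE].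
by split; [exact: (proj1 (derivable1P f x v) dg) | rewrite derive_lineE].
Qed.

(** Only a directional derivative of [f] is at hand. Along the line, derivable means differentiable
    and the usual chain rule applies. *)
Lemma is_derive_comp1 (h : R -> R) (f : V -> R) (x v : V) (df dh : R) :
  is_derive x v f df -> is_derive (f x) 1 h dh ->
  is_derive x v (fun y => h (f y)) (dh * df).
Proof.
move=> /is_derive_line Hf Hh; apply/is_derive_line.
have f0 : f (0 *: v + x) = f x by rewrite scale0r add0r.
rewrite -{1}f0 in Hh.
split.
  apply/derivable1_diffP; apply: (@differentiable_comp _ _ _ _ (fun t : R => f (t *: v + x)) h);
  by apply/derivable1_diffP; apply: ex_derive.
rewrite -derive1E (@derive1_comp _ (fun t : R => f (t *: v + x)) h).
- by rewrite !derive1E !derive_val.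
- exact: ex_derive.
- exact: ex_derive.
Qed.

End Derivation.

(** * Derivatives of functions of the squared distance *)

Section Jets.
Context {R : realType} {n : nat}.
Implicit Types (x y z w : 'rV[R]_n).

(** The square of the distance is smooth at z too, unlike the distance itself. *)
Definition sqdist z x : R := inner (x - z) (x - z).

Lemma sqdist_ge0 z x : 0 <= sqdist z x.
Proof. exact: inner_ge0. Qed.

Lemma sqrt_sqdist z x : Num.sqrt (sqdist z x) = enorm (x - z).
Proof. by []. Qed.

Lemma sqdistE z x : sqdist z x = enorm (x - z) ^+ 2.
Proof. by rewrite enorm2. Qed.

Lemma inner_delta x i : inner x (delta_mx 0 i) = x 0 i.
Proof.
rewrite /inner (bigD1 i)//= !mxE !eqxx mulr1 big1 ?addr0// => j ji.
by rewrite !mxE eqxx (negbTE ji) mulr0.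
Qed.

Lemma is_derive_coord z x i j :
  is_derive x (delta_mx 0 j) (fun y => (y - z) 0 i) (i == j)%:R.
Proof.
apply/is_derive_line.
rewrite (_ : (fun _ => _) = (fun t : R => t * (i == j)%:R + (x - z) 0 i)).
  by apply: is_derive_eq; rewrite ?scaler0 ?addr0 ?add0r /GRing.scale /= ?mulr1.
by apply/funext => t; rewrite !mxE eqxx /= addrA.
Qed.

Lemma is_derive_sqdist z x i :
  is_derive x (delta_mx 0 i) (sqdist z) (2 * (x - z) 0 i).
Proof.
apply/is_derive_line.
rewrite (_ : (fun _ => _) = (fun t : R => t ^+ 2 + t * (2 * (x - z) 0 i) + sqdist z x)).
  by apply: is_derive_eq; rewrite /GRing.scale /=; ring.
apply/funext => t; rewrite /sqdist -addrA; move: (x - z) => d.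
set e := delta_mx 0 i.
rewrite innerDl (innerC (t *: e)) (innerC d) !innerDl (innerC d (t *: e)) !innerZl.
rewrite (innerC e (t *: e)) innerZl (innerC e d) !inner_delta mxE !eqxx /=; ring.
Qed.

Lemma sqdist_continuous z : continuous (sqdist z).
Proof. exact: innerB_continuous. Qed.

(** The quartic term C |x - w|^4 has vanishing first and second derivatives at w: it makes a contact
    at w strict without changing the value of the operator there. The constant [c] adjusts the value
    at w. *)
Definition radial_test (h : R -> R) z (C : R) w (c : R) x : R :=
  h (sqdist z x) + C * sqdist w x ^+ 2 + c.

Section Test.
Variables (h h1 h2 : R -> R) (z w : 'rV[R]_n) (C c : R).
Hypothesis dh : forall q : R, 0 <= q -> is_derive q 1 h (h1 q).
Hypothesis dh1 : forall q : R, 0 <= q -> is_derive q 1 h1 (h2 q).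

Lemma is_derive_radial_test x i :
  is_derive x (delta_mx 0 i) (radial_test h z C w c)
    (h1 (sqdist z x) * (2 * (x - z) 0 i) + C * (4 * sqdist w x * (x - w) 0 i)).
Proof.
have H1 := is_derive_comp1 (is_derive_sqdist z x i) (dh (sqdist_ge0 z x)).
have H2 := is_derive_sqdist w x i.
by apply: is_derive_eq; rewrite /GRing.scale /=; ring.
Qed.

Lemma partial_radial_test i :
  partial i (radial_test h z C w c) =
  fun x => h1 (sqdist z x) * (2 * (x - z) 0 i) + C * (4 * sqdist w x * (x - w) 0 i).
Proof.
by apply/funext => x; have := is_derive_radial_test x i => ?; exact: derive_val.
Qed.

Lemma is_derive_partial_radial_test x i j :
  is_derive x (delta_mx 0 j) (partial i (radial_test h z C w c))
    (h2 (sqdist z x) * (2 * (x - z) 0 j) * (2 * (x - z) 0 i)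
     + h1 (sqdist z x) * (2 * (i == j)%:R)
     + C * (8 * (x - w) 0 j * (x - w) 0 i + 4 * sqdist w x * (i == j)%:R)).
Proof.
rewrite partial_radial_test.
have H1 := is_derive_comp1 (is_derive_sqdist z x j) (dh1 (sqdist_ge0 z x)).
have H2 := is_derive_sqdist w x j.
have H3 := is_derive_coord z x i j.
have H4 := is_derive_coord w x i j.
by apply: is_derive_eq; rewrite /GRing.scale /=; ring.
Qed.

End Test.
End Jets.

(** * Radial functions in the viscosity inequalities *)

Section Radial.
Context {R : realType} {n : nat}.
Implicit Types (x y z w : 'rV[R]_n) (Omega : set 'rV[R]_n) (u : 'rV[R]_n -> R).

(** The derivatives are two-sided at q = 0 as well, so that composition with [sqdist z] is C^2 at z
    itself. *)
Definition C2_halfline (h h1 h2 : R -> R) : Prop :=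
  forall q : R, 0 <= q -> [/\ is_derive q 1 h (h1 q), is_derive q 1 h1 (h2 q) &
                          {for q, continuous h2}].

Lemma C2_halflineN h h1 h2 : C2_halfline h h1 h2 ->
  C2_halfline (fun q => - h q) (fun q => - h1 q) (fun q => - h2 q).
Proof.
move=> H q q0; have [H1 H2 H3] := H q q0.
split; [exact: is_deriveN | exact: is_deriveN |].
by apply: continuousN.
Qed.

Lemma is_derive_continuous (h : R -> R) (q d : R) :
  is_derive q 1 h d -> {for q, continuous h}.
Proof.
by move=> H; apply: differentiable_continuous; apply/derivable1_diffP.
Qed.

Section Test.
Variables (h h1 h2 : R -> R) (z w : 'rV[R]_n) (C c : R).
Hypothesis hC2 : C2_halfline h h1 h2.

Let dh (q : R) : 0 <= q -> is_derive q 1 h (h1 q). Proof. by move=> /hC2[]. Qed.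
Let dh1 (q : R) : 0 <= q -> is_derive q 1 h1 (h2 q). Proof. by move=> /hC2[]. Qed.

Lemma Ck_radial_test Omega : Ck 2 Omega (radial_test h z C w c).
Proof.
have csq y x : {for x, continuous (sqdist y)} by exact: sqdist_continuous.
have cco y i x : {for x, continuous (fun t : 'rV[R]_n => (t - y) 0 i)}.
  have -> : (fun t : 'rV[R]_n => (t - y) 0 i) = (fun t => t 0 i - y 0 i).
    by apply/funext => t; rewrite !mxE.
  by apply: continuousB; [exact: coord_continuous | exact: cst_continuous].
have chs (k : R -> R) x : {for sqdist z x, continuous k} ->
    {for x, continuous (fun t => k (sqdist z t))}.
  by move=> ck; apply: continuous_comp.
have cst k x : {for x, continuous (fun _ : 'rV[R]_n => k : R)} by exact: cst_continuous.
have ch x : {for sqdist z x, continuous h}.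
  by apply: is_derive_continuous; apply: dh; exact: sqdist_ge0.
have ch1 x : {for sqdist z x, continuous h1}.
  by apply: is_derive_continuous; apply: dh1; exact: sqdist_ge0.
have ch2 x : {for sqdist z x, continuous h2}.
  by have [] := hC2 (sqdist_ge0 z x).
split.
  move=> x _; apply: continuousD => //; apply: continuousD; first exact: chs.
  apply: continuousM => //; apply: (@continuous_comp _ _ _ (sqdist w) (fun t : R => t ^+ 2)) => //.
  exact: exprn_continuous.
move=> i; split.
  by move=> x _; have := is_derive_radial_test z w C c dh x i => ?; exact: ex_derive.
split.
  move=> x _; rewrite (partial_radial_test _ _ _ _ dh).
  apply: continuousD; apply: continuousM => //; first exact: chs.
  - by apply: continuousM.
  - by apply: continuousM => //; apply: continuousM.
move=> j; split.
  move=> x _; have := is_derive_partial_radial_test z w C c dh dh1 x i j => ?.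
  exact: ex_derive.
split=> // x _.
have -> : partial j (partial i (radial_test h z C w c)) = fun x =>
    (h2 (sqdist z x) * (2 * (x - z) 0 j) * (2 * (x - z) 0 i)
     + h1 (sqdist z x) * (2 * (i == j)%:R)
     + C * (8 * (x - w) 0 j * (x - w) 0 i + 4 * sqdist w x * (i == j)%:R)).
  apply/funext => y; have := is_derive_partial_radial_test z w C c dh dh1 y i j => ?.
  exact: derive_val.
apply: continuousD; first apply: continuousD.
- apply: continuousM; last by apply: continuousM.
  by apply: continuousM; [exact: chs | apply: continuousM].
- by apply: continuousM => //; exact: chs.
- apply: continuousM => //; apply: continuousD; last first.
    by apply: continuousM => //; apply: continuousM.
  by apply: continuousM => //; apply: continuousM.
Qed.

Let a := h1 (sqdist z w).
Let b := h2 (sqdist z w).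
Let q := sqdist z w.

Lemma sqdist_self : sqdist w w = 0.
Proof. by rewrite sqdistE subrr enorm0 expr0n. Qed.

Lemma grad_radial_test :
  grad (radial_test h z C w c) w = (2 * a) *: (w - z).
Proof.
apply/rowP => i; rewrite !mxE (partial_radial_test _ _ _ _ dh) /= sqdist_self -/a !mxE.
by rewrite mulr0 mul0r mulr0 addr0 mulrCA mulrA.
Qed.

(** With d = w - z, the gradient at w is 2 a d and the Hessian is 4 b d d^T + 2 a Id, and |d|^2 =
    q. *)
Lemma inf_laplacian_radial_test :
  inf_laplacian (radial_test h z C w c) w = 4 * a ^+ 2 * q * (4 * b * q + 2 * a).
Proof.
pose d := w - z.
have -> : inf_laplacian (radial_test h z C w c) w =
  \sum_(i < n) \sum_(j < n) ((16 * a ^+ 2 * b) * (d 0 i ^+ 2 * d 0 j ^+ 2) +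
     (8 * a ^+ 3) * (d 0 i * d 0 j * (i == j)%:R)).
  apply: eq_bigr => i _; apply: eq_bigr => j _.
  have := is_derive_partial_radial_test z w C c dh dh1 w i j => ?.
  rewrite {3}/partial derive_val !(partial_radial_test _ _ _ _ dh) /= sqdist_self -/a -/b -/d.
  by rewrite subrr !mxE; ring.
under eq_bigr => i _ do
  rewrite big_split /= -[X in X + _]mulr_sumr -[X in _ + X]mulr_sumr.
rewrite big_split /= -[X in X + _]mulr_sumr -[X in _ + X]mulr_sumr.
have -> : \sum_(i < n) \sum_(j < n) (d 0 i * d 0 j * (i == j)%:R) = q.
  apply: eq_bigr => i _; rewrite (bigD1 i)//= eqxx mulr1 big1 ?addr0// => j ji.
  by rewrite eq_sym (negbTE ji) mulr0.
have -> : \sum_(i < n) \sum_(j < n) (d 0 i ^+ 2 * d 0 j ^+ 2) = q * q.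
  under eq_bigr => i _ do rewrite -mulr_sumr.
  by rewrite -mulr_suml; congr (_ * _); apply: eq_bigr => i _; rewrite expr2.
by ring.
Qed.

End Test.

Lemma enorm_grad_radial_test h h1 h2 z w C c :
  C2_halfline h h1 h2 ->
  enorm (grad (radial_test h z C w c) w) =
    2 * `|h1 (sqdist z w)| * Num.sqrt (sqdist z w).
Proof.
by move=> hC2; rewrite (grad_radial_test _ _ _ _ hC2) enormZ normrM ger0_norm.
Qed.

(** The common frame for both equations: on radial functions the operator is the infinity Laplacian
    up to E T^3 |ln T|, where T is the length of the gradient. E = 0 covers the equation of v, E >=
    |grad ln p| that of u. *)
Definition radial_op (E : R) Omega (Op : ('rV[R]_n -> R) -> 'rV[R]_n -> R) : Prop :=
  forall h h1 h2 z w C c, C2_halfline h h1 h2 -> Omega w ->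
  forall q T : R, q = sqdist z w -> T = 2 * `|h1 q| * Num.sqrt q ->
  `|Op (radial_test h z C w c) w - 4 * h1 q ^+ 2 * q * (4 * h2 q * q + 2 * h1 q)| <=
    T ^+ 2 * (E * `|T * ln T|).

Lemma radial_inf_laplacian (E : R) Omega : 0 <= E -> radial_op E Omega inf_laplacian.
Proof.
move=> E0 h h1 h2 z w C c hC2 _ q T -> _.
rewrite (inf_laplacian_radial_test _ _ _ _ hC2) subrr normr0.
by rewrite mulr_ge0 ?sqr_ge0// mulr_ge0.
Qed.

Lemma radial_infx_laplacian (E : R) Omega p :
  (forall x, Omega x -> enorm (grad (fun y => ln (p y)) x) <= E) ->
  radial_op E Omega (infx_laplacian p).
Proof.
move=> pE h h1 h2 z w C c hC2 Ow q T -> TE.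
rewrite /infx_laplacian (inf_laplacian_radial_test _ _ _ _ hC2) addrC addKr.
have Tg := enorm_grad_radial_test z w C c hC2.
rewrite -TE in Tg; rewrite Tg 2!normrM (ger0_norm (sqr_ge0 T)).
have T0 : 0 <= T by rewrite TE !mulr_ge0// sqrtr_ge0.
have : `|inner (grad (radial_test h z C w c) w) (grad (fun y => ln (p y)) w)| <= T * E.
  by apply: le_trans (inner_norm_le _ _) _; rewrite Tg ler_wpM2l// pE.
move=> /(ler_wpM2l (normr_ge0 (ln T))) /(ler_wpM2l (sqr_ge0 T)).
rewrite normrM (ger0_norm T0) !mulrA => /le_trans; apply.
by rewrite le_eqVlt; apply/orP; left; apply/eqP; ring.
Qed.

(* The viscosity inequality tested with radial functions h(|x - z|^2), divided
   by |grad|^2: the second radial derivative is 4 q h'' + 2 h', the gradient has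
   length T. *)
Definition radial_sub (E : R) Omega u : Prop :=
  forall z w h h1 h2 (r M : R), Omega w -> C2_halfline h h1 h2 -> 0 < r ->
  (forall x, Omega x -> sqdist w x < r ->
     u x - h (sqdist z x) <= u w - h (sqdist z w)) ->
  (forall x, Omega x -> u x - h (sqdist z x) <= M) ->
  let q := sqdist z w in let T := 2 * h1 q * Num.sqrt q in
  0 < h1 q -> 0 < q -> 0 <= 4 * h2 q * q + 2 * h1 q + E * `|T * ln T|.

(** Viscosity test functions must touch strictly on all of [Omega]. The quartic term gives
    strictness where [sqdist w] is below r, and C r^2 is chosen to exceed the global bound [M]
    elsewhere. *)
Lemma strict_radial_test Omega u z w h (r M : R) : 0 < r ->
  (forall x, Omega x -> sqdist w x < r ->
     u x - h (sqdist z x) <= u w - h (sqdist z w)) ->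
  (forall x, Omega x -> u x - h (sqdist z x) <= M) ->
  exists2 C : R, 0 < C & forall x, Omega x -> x <> w ->
    u x < radial_test h z C w (u w - h (sqdist z w)) x.
Proof.
move=> r0 hloc hglob.
exists ((`|M| + `|u w - h (sqdist z w)| + 1) / r ^+ 2).
  by rewrite divr_gt0 ?exprn_gt0// ltr_wpDl// addr_ge0.
move=> x Ox xw; rewrite /radial_test.
set C := _ / _.
have C0 : 0 < C by rewrite divr_gt0 ?exprn_gt0// ltr_wpDl// addr_ge0.
have sx : 0 < sqdist w x.
  rewrite sqdistE exprn_gt0// lt_neqAle enorm_ge0 andbT eq_sym.
  by apply/eqP => /enorm_eq0/eqP; rewrite subr_eq0 => /eqP.
have [xr|rx] := ltP (sqdist w x) r.
  have := hloc x Ox xr; have : 0 < C * sqdist w x ^+ 2 by rewrite mulr_gt0// exprn_gt0.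
  lra.
have : C * r ^+ 2 <= C * sqdist w x ^+ 2.
  by rewrite ler_pM2l// ler_pXn2r ?nnegrE ?(ltW r0) ?(ltW sx).
rewrite divfK ?gt_eqF ?exprn_gt0//.
have := hglob x Ox; have := ler_norm M; have := ler_norm (- (u w - h (sqdist z w))).
rewrite normrN; lra.
Qed.

Lemma subsolution_radial_sub E Omega Op u : radial_op E Omega Op ->
  viscosity_subsolution Omega Op (EFin \o u) -> radial_sub E Omega u.
Proof.
move=> opE [_ _ usub] z w h h1 h2 r M Ow hC2 r0 hloc hglob q T a0 q0.
have [C _ hC] := strict_radial_test r0 hloc hglob.
have := usub w (radial_test h z C w (u w - h (sqdist z w))) Ow (Ck_radial_test _ _ _ _ hC2 _).
rewrite /= {1}/radial_test sqdist_self expr0n mulr0 addr0 addrC subrK.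
move=> /(_ erefl) usub'.
have {}usub' := usub' (fun x Ox xw => hC x Ox xw).
have /= := opE h h1 h2 z w C (u w - h (sqdist z w)) hC2 Ow q T erefl.
rewrite gtr0_norm// => /(_ erefl); rewrite ler_distl => /andP[_ le2].
have T2 : T ^+ 2 = 4 * h1 q ^+ 2 * q.
  by rewrite /T !exprMn sqr_sqrtr ?ltW//; ring.
have T20 : 0 < T ^+ 2 by rewrite T2 !mulr_gt0// exprn_gt0.
have := le_trans usub' le2; rewrite -T2 -mulrDr pmulr_rge0//.
Qed.

(** Testing from below with -h and -C: the error bound in [radial_op] is even in h, so -u obeys the
    same inequality as a subsolution. Everything proved for [radial_sub] then serves both sides. *)
Lemma supersolution_radial_sub E Omega Op u : radial_op E Omega Op ->
  viscosity_supersolution Omega Op (EFin \o u) -> radial_sub E Omega (fun x => - u x).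
Proof.
move=> opE [_ _ usup] z w h h1 h2 r M Ow hC2 r0 hloc hglob q T a0 q0.
have [C _ hC] := strict_radial_test r0 hloc hglob.
pose c := h (sqdist z w) + u w.
have hN := C2_halflineN hC2.
have usup' : Op (radial_test (fun q => - h q) z (- C) w c) w <= 0.
  apply: usup => //; first exact: (Ck_radial_test _ _ _ _ hN _).
    by rewrite /= /radial_test sqdist_self expr0n mulr0 addr0 /c addKr.
  move=> x Ox xw; rewrite lte_fin.
  by have := hC x Ox xw; rewrite /radial_test /c; lra.
have /= := opE _ _ _ z w (- C) c hN Ow q T erefl.
rewrite normrN gtr0_norm// => /(_ erefl); rewrite ler_distl => /andP[le1 _].
have T2 : T ^+ 2 = 4 * h1 q ^+ 2 * q.
  by rewrite /T !exprMn sqr_sqrtr ?ltW//; ring.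
have T20 : 0 < T ^+ 2 by rewrite T2 !mulr_gt0// exprn_gt0.
have := le_trans le1 usup'.
rewrite sqrrN -T2 -mulrBr pmulr_rle0//.
by rewrite !mulrN !mulNr; lra.
Qed.

End Radial.

(** * Comparison with cones *)

Section Cone.
Context {R : realType} {n : nat}.
Implicit Types (x y z w : 'rV[R]_n) (Omega : set 'rV[R]_n) (u : 'rV[R]_n -> R).

(** Apply ln s < s to s = t and to s = 1 / t. *)
Lemma norm_mul_ln_le (t : R) : 0 < t -> `|t * ln t| <= t ^+ 2 + 1.
Proof.
move=> t0; have h1 := ln_sublinear t0.
have ti0 : 0 < t^-1 by rewrite invr_gt0.
have := ln_sublinear ti0; rewrite lnV// => h2.
rewrite ler_norml; apply/andP; split.
  have : t * - ln t < t * t^-1 by rewrite ltr_pM2l.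
  rewrite mulfV ?gt_eqF// mulrN; have := sqr_ge0 t; lra.
have : t * ln t < t * t by rewrite ltr_pM2l.
by rewrite -expr2; lra.
Qed.

Definition eball z (r : R) : set 'rV[R]_n := [set x | enorm (x - z) <= r].

Lemma eball_center z (r : R) : 0 <= r -> eball z r z.
Proof. by move=> r0; rewrite /eball /= subrr enorm0. Qed.

Lemma eball_sym x y (r : R) : eball x r y -> eball y r x.
Proof. by rewrite /eball /= enorm_distC. Qed.

Lemma closed_eball z (r : R) : closed (eball z r).
Proof.
rewrite (_ : eball z r = (fun x => enorm (x - z)) @^-1` [set t | t <= r])//.
by apply: preimage_closed; [move=> x _; exact: enormB_continuous | exact: closed_le].
Qed.

Lemma compact_eball z (r : R) : compact (eball z r).
Proof.
apply: bounded_closed_compact; last exact: closed_eball.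
exists (`|z| + r); split; first exact: num_real.
move=> M zrM x zx; apply: le_trans (ltW zrM).
rewrite -[x](subrK z) addrC (le_trans (ler_normD _ _))// lerD2l.
exact: le_trans (mxnorm_le_enorm _) zx.
Qed.

(* sqrt (q + rho ^+ 2) smooths the cone sqrt q = |x - z| at its tip. *)
Lemma C2_smooth_cone (a b rho : R) : 0 < rho ->
  let S q := Num.sqrt (q + rho ^+ 2) in
  C2_halfline (fun q => a * S q - b / 2 * q) (fun q => a / 2 * (S q)^-1 - b / 2)
    (fun q => - (a / 4 * (S q)^-1 ^+ 3)).
Proof.
move=> rho0 S q q0.
have qr : 0 < q + rho ^+ 2 by rewrite ltr_wpDl// exprn_gt0.
have S0 : 0 < S q by rewrite sqrtr_gt0.
have dS : is_derive q 1 S ((2 * S q)^-1).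
  have H1 : is_derive q 1 (fun t : R => t + rho ^+ 2) 1.
    by apply: is_derive_eq; rewrite addr0.
  by have := is_derive_comp1 H1 (is_derive1_sqrt qr); rewrite mulr1.
have dSV := @is_deriveV R S q _ 1 (lt0r_neq0 S0) dS.
split.
- by apply: is_derive_eq; rewrite /GRing.scale /=; field; rewrite gt_eqF.
- by apply: is_derive_eq; rewrite /GRing.scale /=; field; rewrite gt_eqF.
- have cS : {for q, continuous (fun t => (S t)^-1)}.
    by apply: continuousV; [rewrite gt_eqF | exact: is_derive_continuous dS].
  apply: continuousN; apply: continuousM; first exact: cst_continuous.
  apply: (@continuous_comp _ _ _ (fun t => (S t)^-1) (fun t : R => t ^+ 3)) => //.
  exact: exprn_continuous.
Qed.

(** The smoothed cone has second radial derivative close to -b, while at slopes at most [a] the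
    inequality for u forbids values below -E (a^2 + 1). So u minus the cone has no interior maximum
    away from the tip. The condition b r < a keeps the cone increasing on the ball. *)
Lemma cone_comparison (E : R) Omega u z (r a b D M : R) :
  0 <= E -> radial_sub E Omega u -> {within closure Omega, continuous u} ->
  (forall x y, Omega x -> Omega y -> enorm (x - y) <= D) ->
  (forall x, Omega x -> u x <= M) ->
  eball z r `<=` Omega -> 0 < a -> E * (a ^+ 2 + 1) < b -> b * r < a ->
  (forall x, enorm (x - z) = r -> u x <= u z + a * r - b / 2 * r ^+ 2) ->
  forall y, eball z r y ->
    u y <= u z + a * enorm (y - z) - b / 2 * enorm (y - z) ^+ 2.
Proof.
move=> E0 usub uc OD uM zrO a0 Eb bra usph y zry; rewrite leNgt; apply/negP => uy.
pose t := enorm (y - z).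
pose theta := u y - (u z + a * t - b / 2 * t ^+ 2).
have th0 : 0 < theta by rewrite subr_gt0.
have thE : u y = theta + (u z + a * t - b / 2 * t ^+ 2) by rewrite subrK.
move: theta th0 thE => theta th0 thE.
have b0 : 0 < b by apply: le_lt_trans Eb; rewrite mulr_ge0// addr_ge0// sqr_ge0.
have t0 : 0 <= t by exact: enorm_ge0.
have tr : t <= r by [].
have r0 : 0 <= r by exact: le_trans tr.
have zO : Omega z by apply: zrO; exact: eball_center.
(* Within [r1] of the tip u moves by less than half of the excess theta, so the maximum point found
   below cannot lie there. *)
have [r1 r10 hr1] := within_continuous_enorm uc (subset_closure zO) (divr_gt0 th0 (@ltr0n _ 2)).
pose k := b - E * (a ^+ 2 + 1).
have k0 : 0 < k by rewrite subr_gt0.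
(* The four bounds give in turn: rho^2 <= rho; smoothing costs at most a quarter of theta; its
   curvature error a rho^2 / S^3 stays below [k] at distance at least [r1]; the smoothed cone is
   still increasing. *)
pose rho := Num.min (Num.min 1 (theta / (4 * a)))
  (Num.min (k * r1 ^+ 3 / (2 * a)) ((a - b * r) / (2 * b))).
have rho0 : 0 < rho.
  rewrite !lt_min ltr01 !divr_gt0 ?mulr_gt0 ?subr_gt0 ?exprn_gt0//.
have rho1 : rho <= 1 by rewrite !ge_min lexx.
have rho2 : a * rho <= theta / 4.
  have : rho <= theta / (4 * a) by rewrite !ge_min lexx !orbT.
  rewrite ler_pdivlMr ?mulr_gt0//; lra.
have rho3 : a * rho ^+ 2 < k * r1 ^+ 3.
  have : rho <= k * r1 ^+ 3 / (2 * a) by rewrite !ge_min lexx !orbT.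
  rewrite ler_pdivlMr ?mulr_gt0// => h.
  have : rho ^+ 2 <= rho by rewrite expr2 ler_piMl// ltW.
  rewrite -(ler_pM2l a0) => h2.
  have : 0 < k * r1 ^+ 3 by rewrite mulr_gt0// exprn_gt0.
  lra.
have rho4 : b * (r + rho) < a.
  have : rho <= (a - b * r) / (2 * b) by rewrite !ge_min lexx !orbT.
  rewrite ler_pdivlMr ?mulr_gt0//; lra.
pose S q := Num.sqrt (q + rho ^+ 2).
have S0 q : 0 <= q -> 0 < S q.
  by move=> q0; rewrite sqrtr_gt0 ltr_wpDl// exprn_gt0.
have Sl x : enorm (x - z) <= S (sqdist z x).
  by rewrite -sqrt_sqdist; apply: ler_wsqrtr; rewrite lerDl sqr_ge0.
have Su x : S (sqdist z x) <= enorm (x - z) + rho.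
  rewrite -[leRHS]ger0_norm ?addr_ge0 ?enorm_ge0 ?(ltW rho0)// -sqrtr_sqr.
  apply: ler_wsqrtr.
  rewrite sqdistE sqrrD.
  have : 0 <= enorm (x - z) * rho by rewrite mulr_ge0 ?enorm_ge0// ltW.
  lra.
pose h q := a * S q - b / 2 * q.
have hC2 := C2_smooth_cone a b rho0.
have hl x : a * enorm (x - z) - b / 2 * enorm (x - z) ^+ 2 <= h (sqdist z x).
  by rewrite /h -sqdistE lerB// ler_pM2l.
have hu x : h (sqdist z x) <= a * (enorm (x - z) + rho) - b / 2 * enorm (x - z) ^+ 2.
  by rewrite /h -sqdistE lerB// ler_pM2l.
have ucB : {within eball z r, continuous u}.
  by apply: continuous_subspaceW uc => x /zrO; exact: subset_closure.
have [w zrw wmax] : exists2 w, eball z r w & forall x, eball z r x ->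
    u x - h (sqdist z x) <= u w - h (sqdist z w).
  apply: (@compact_attains_max _ _ _ (fun x => u x - h (sqdist z x))).
  - exact: compact_eball.
  - by exists y.
  - apply/subspace_continuousP => x Bx; apply: cvgB.
      by move/subspace_continuousP : ucB; exact.
    apply: cvg_within_filter; apply: (@continuous_comp _ _ _ (sqdist z) h).
      exact: sqdist_continuous.
    by have [H _ _] := hC2 _ (sqdist_ge0 z x); exact: is_derive_continuous H.
(* This lower bound excludes the sphere, by hypothesis, and the ball of radius [r1], by
   continuity. *)
have wbig : u z + theta / 2 < u w - h (sqdist z w).
  have := wmax y zry; have := hu y; rewrite -/t thE; lra.
have wr : enorm (w - z) < r.
  rewrite lt_neqAle zrw andbT; apply/eqP => wr.
  have := usph w wr; have := hl w; rewrite wr; lra.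
have rw : r1 <= enorm (w - z).
  rewrite leNgt; apply/negP => rw.
  have := hr1 w (subset_closure (zrO _ zrw)) rw; rewrite ltr_norml => /andP[_ h1].
  have h2 := hl w.
  have : b / 2 * enorm (w - z) ^+ 2 <= a * enorm (w - z).
    rewrite expr2 mulrA ler_wpM2r ?enorm_ge0//.
    have : b * enorm (w - z) <= b * r by rewrite ler_pM2l.
    have : 0 <= b * enorm (w - z) by rewrite mulr_ge0 ?enorm_ge0// ltW.
    lra.
  lra.
have Ow : Omega w by exact: zrO.
have loc_gt0 : 0 < (r - enorm (w - z)) ^+ 2 by rewrite exprn_gt0// subr_gt0.
have hloc x : Omega x -> sqdist w x < (r - enorm (w - z)) ^+ 2 ->
    u x - h (sqdist z x) <= u w - h (sqdist z w).
  rewrite sqdistE ltr_pXn2r ?nnegrE ?enorm_ge0 ?subr_ge0 ?(ltW wr)// => _ xw.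
  apply: wmax; rewrite /eball /=; apply: le_trans (enorm_triangle w _ _) _; lra.
have hglob x : Omega x -> u x - h (sqdist z x) <= M + b / 2 * D ^+ 2.
  move=> Ox; have := uM x Ox.
  have hx : enorm (x - z) <= D by exact: OD.
  have : enorm (x - z) ^+ 2 <= D ^+ 2.
    by rewrite ler_pXn2r ?nnegrE ?enorm_ge0// (le_trans _ hx) ?enorm_ge0.
  rewrite -(ler_pM2l (divr_gt0 b0 (@ltr0n _ 2))) => h1.
  have h2 : 0 <= a * enorm (x - z) by rewrite mulr_ge0 ?enorm_ge0// ltW.
  have := hl x; lra.
set s := enorm (w - z) in wr rw loc_gt0 hloc *.
have s0 : 0 < s by exact: lt_le_trans rw.
have qE : sqdist z w = s ^+ 2 by rewrite sqdistE.
have q0 : 0 < sqdist z w by rewrite qE exprn_gt0.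
have := usub z w h _ _ _ _ Ow hC2 loc_gt0 hloc hglob.
rewrite /= sqrt_sqdist -/s -/(S _) qE.
have Sq0 : 0 < S (s ^+ 2) by rewrite -qE; apply: S0; exact: ltW.
have S2 : S (s ^+ 2) ^+ 2 = s ^+ 2 + rho ^+ 2.
  by rewrite sqr_sqrtr// addr_ge0// sqr_ge0.
have sS : s <= S (s ^+ 2) by rewrite -qE; exact: Sl.
have Ss : S (s ^+ 2) <= s + rho by rewrite -qE; exact: Su.
move: (S (s ^+ 2)) Sq0 S2 sS Ss => Q Q0 Q2 sQ Qs.
set V := Q^-1; have V0 : 0 < V by rewrite invr_gt0.
have VQ : V * Q = 1 by rewrite mulVf// gt_eqF.
have aV : b < a * V.
  rewrite -(ltr_pM2r Q0) -mulrA VQ mulr1; apply: le_lt_trans rho4.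
  by rewrite ler_pM2l//; apply: le_trans Qs _; rewrite lerD2r ltW.
have h10 : 0 < a / 2 * V - b / 2 by lra.
have s20 : 0 < s ^+ 2 by rewrite exprn_gt0.
move=> /(_ h10 s20); apply/negP; rewrite -ltNge.
set T := _ * s.
have T0 : 0 < T by rewrite mulr_gt0// mulr_gt0.
have Vs : V * s <= 1 by rewrite -VQ ler_pM2l.
have Ta : T <= a.
  have -> : T = a * (V * s) - b * s by rewrite /T; field.
  have : a * (V * s) <= a * 1 by rewrite ler_pM2l.
  have : 0 < b * s by rewrite mulr_gt0.
  lra.
have h3 : E * `|T * ln T| <= E * (a ^+ 2 + 1).
  apply: ler_wpM2l => //; apply: le_trans (norm_mul_ln_le T0) _.
  by rewrite lerD2r ler_pXn2r ?nnegrE ?(ltW T0) ?(ltW a0).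
have h4 : a * rho ^+ 2 * V ^+ 3 < k.
  have V3 : 0 < V ^+ 3 by rewrite exprn_gt0.
  apply: (@lt_le_trans _ _ (k * r1 ^+ 3 * V ^+ 3)); first by rewrite ltr_pM2r.
  have rV0 : 0 <= r1 * V by rewrite mulr_ge0 ?(ltW r10) ?(ltW V0).
  have rV1 : r1 * V <= 1 by apply: le_trans Vs; rewrite mulrC ler_pM2l.
  by rewrite -mulrA -exprMn ler_piMr ?(ltW k0) ?exprn_ile1.
(* Second radial derivative of the smoothed cone, from Q^2 = s^2 + rho^2 and V = 1 / Q. *)
have -> : 4 * - (a / 4 * V ^+ 3) * s ^+ 2 + 2 * (a / 2 * V - b / 2) =
    a * rho ^+ 2 * V ^+ 3 - b.
  have -> : rho ^+ 2 = Q ^+ 2 - s ^+ 2 by rewrite Q2; ring.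
  have -> : a * (Q ^+ 2 - s ^+ 2) * V ^+ 3 = a * V * (V * Q) ^+ 2 - a * s ^+ 2 * V ^+ 3 by ring.
  by rewrite VQ; field.
by rewrite /k in h4; lra.
Qed.

End Cone.

(** * The maximum principle *)

Section MaximumPrinciple.
Context {R : realType} {n : nat}.
Implicit Types (x y z w : 'rV[R]_n) (Omega : set 'rV[R]_n) (u : 'rV[R]_n -> R).

Lemma C2_double_exp (B l : R) :
  let Y q := B * expR (l * q) in
  C2_halfline (fun q => - expR (- Y q)) (fun q => l * Y q * expR (- Y q))
    (fun q => l ^+ 2 * Y q * (1 - Y q) * expR (- Y q)).
Proof.
move=> Y q q0.
have dY : is_derive q 1 Y (l * Y q).
  have dl : is_derive q 1 (fun t : R => l * t) l.
    by apply: is_derive_eq; rewrite /GRing.scale /= mulr1.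
  have := is_derive_comp1 dl (is_derive_expR (l * q)) => dE.
  by apply: is_derive_eq; rewrite /Y /GRing.scale /=; ring.
have dN : is_derive q 1 (fun t => - Y t) (- (l * Y q)) by exact: is_deriveN.
have dE := is_derive_comp1 dN (is_derive_expR (- Y q)).
split.
- by apply: is_derive_eq; rewrite /GRing.scale /=; ring.
- by apply: is_derive_eq; rewrite /GRing.scale /=; ring.
- apply: (@is_derive_continuous _ _ _ (l ^+ 2 * (l * Y q) * (1 - Y q) * expR (- Y q)
    + l ^+ 2 * Y q * (- (l * Y q)) * expR (- Y q)
    + l ^+ 2 * Y q * (1 - Y q) * (- (l * Y q) * expR (- Y q)))).
  by apply: is_derive_eq; rewrite /GRing.scale /=; ring.
Qed.

Lemma closure_not_frontier Omega x : closure Omega x -> ~ frontier Omega x -> Omega x.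
Proof.
move=> cx nfx; apply: contrapT => nOx.
by apply: nfx; split=> // /interior_subset.
Qed.

(* The test function -exp (-Y), Y = B exp (l q), is so flat that the logarithm of
   its slope is about -Y, while -h'' / h' is about l Y: this beats the logarithm
   in the equation for any E, on a domain of any size. *)
Lemma max_principle (E D K : R) Omega u :
  (0 < n)%N -> 0 <= E -> compact (closure Omega) ->
  (forall x y, Omega x -> Omega y -> enorm (x - y) <= D) ->
  radial_sub E Omega u -> {within closure Omega, continuous u} ->
  (forall x, frontier Omega x -> u x <= K) -> forall x, Omega x -> u x <= K.
Proof.
move=> n0 E0 cO OD usub uc uK x1 Ox1; rewrite leNgt; apply/negP => ux1.
pose e : 'rV[R]_n := delta_mx 0 (Ordinal n0).
have e1 : enorm e = 1.
  by rewrite /enorm inner_delta /e mxE !eqxx sqrtr1.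
have D0 : 0 <= D by apply: le_trans (OD _ _ Ox1 Ox1); exact: enorm_ge0.
(* A centre at distance at least 1 from all of [Omega]. *)
pose z := x1 - (D + 1) *: e.
have zO x : Omega x -> 1 <= enorm (x - z).
  move=> Ox; have := enormD (x - z) (x1 - x).
  have -> : x - z + (x1 - x) = (D + 1) *: e.
    by rewrite addrC addrA subrK opprB addrC subrK.
  rewrite enormZ e1 mulr1 ger0_norm ?addr_ge0//.
  have := OD _ _ Ox1 Ox; lra.
pose theta := u x1 - K.
have th0 : 0 < theta by rewrite subr_gt0.
(* exp B >= 1 + B > 1 / theta, so the oscillation of h is below the excess theta and the maximum of
   u - h is not on the frontier. *)
pose B := 2 + theta^-1.
have B2 : 2 <= B by rewrite lerDl invr_ge0 ltW.
have eB : expR (- B) < theta.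
  rewrite expRN invf_plt ?posrE ?expR_gt0//; apply: lt_le_trans (expR_ge1Dx B).
  by rewrite /B; lra.
(* At the end - 2 l q Y = - (8 E + 6) q Y has to beat 6 E q Y + 2, with q Y >= 2. *)
pose l := 4 * E + 3.
have l3 : 3 <= l by rewrite /l; lra.
pose Yf (q : R) := B * expR (l * q).
have Yge q : 0 <= q -> B * (1 + l * q) <= Yf q.
  by move=> q0; rewrite ler_pM2l ?expR_ge1Dx//; lra.
have YB q : 0 <= q -> B <= Yf q.
  move=> q0; apply: le_trans (Yge q q0).
  have : 0 <= B * (l * q) by rewrite !mulr_ge0//; lra.
  lra.
pose h (q : R) := - expR (- Yf q).
have hl q : 0 <= q -> - expR (- B) <= h q.
  by move=> q0; rewrite lerN2 ler_expR lerN2 YB.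
have hu q : h q <= 0 by rewrite oppr_le0 expR_ge0.
have hC2 := C2_double_exp B l.
have [w cw wmax] : exists2 w, closure Omega w & forall x, closure Omega x ->
    u x - h (sqdist z x) <= u w - h (sqdist z w).
  apply: (@compact_attains_max _ _ _ (fun x => u x - h (sqdist z x))) => //.
  - by exists x1; exact: subset_closure.
  - apply/subspace_continuousP => x Bx; apply: cvgB.
      by move/subspace_continuousP : uc; exact.
    apply: cvg_within_filter; apply: (@continuous_comp _ _ _ (sqdist z) h).
      exact: sqdist_continuous.
    by have [H _ _] := hC2 _ (sqdist_ge0 z x); exact: is_derive_continuous H.
have Ow : Omega w.
  apply: closure_not_frontier => // /uK.
  have := wmax x1 (subset_closure Ox1); have := hu (sqdist z x1).
  have := hl _ (sqdist_ge0 z w); rewrite /theta in eB; lra.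
have hloc x : Omega x -> sqdist w x < 1 -> u x - h (sqdist z x) <= u w - h (sqdist z w).
  by move=> Ox _; apply: wmax; exact: subset_closure.
have hglob x : Omega x -> u x - h (sqdist z x) <= u w - h (sqdist z w).
  by move=> Ox; apply: wmax; exact: subset_closure.
have := usub z w h _ _ _ _ Ow hC2 ltr01 hloc hglob.
have s1 := zO w Ow; rewrite /= sqrt_sqdist.
set s := enorm (w - z) in s1 *.
have -> : sqdist z w = s ^+ 2 by rewrite sqdistE.
rewrite -/(Yf _).
have q1 : 1 <= s ^+ 2 by rewrite exprn_ege1.
have sq : s <= s ^+ 2 by rewrite expr2 ler_peMl//; lra.
have Yg := Yge (s ^+ 2) (le_trans ler01 q1).
have Y2 := le_trans B2 (YB (s ^+ 2) (le_trans ler01 q1)).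
move: (Yf (s ^+ 2)) Yg Y2 => Y Yg Y2.
set A := expR (- Y); have A0 : 0 < A by exact: expR_gt0.
set q := s ^+ 2 in q1 sq Yg *.
have Y0 : 0 < Y by lra.
have l0 : 0 < l by lra.
have s0 : 0 < s by lra.
have lq0 : 0 < l * q by rewrite mulr_gt0//; lra.
have Ylq : 2 * (l * q) <= Y.
  apply: le_trans Yg; have : 2 * (1 + l * q) <= B * (1 + l * q) by rewrite ler_wpM2r//; lra.
  lra.
have h10 : 0 < l * Y * A by rewrite !mulr_gt0.
have q0 : 0 < q by lra.
move=> /(_ h10 q0); apply/negP; rewrite -ltNge.
have -> : 2 * (l * Y * A) * s = 2 * l * s * Y * A by ring.
have c0 : 0 < 2 * l * s by rewrite !mulr_gt0.
(* Since 2 l s <= 2 l q <= Y, both logarithms on the right lie between 0 and Y; hence |ln T| <= 3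
   Y. *)
have lnT : ln (2 * l * s * Y * A) = ln (2 * l * s) + ln Y - Y.
  by rewrite !lnM ?posrE ?mulr_gt0// expRK.
have ls : l * s <= l * q by rewrite ler_pM2l.
have l1s : 1 <= l * s by rewrite (le_trans s1)// ler_peMl//; lra.
have L1 : 0 <= ln (2 * l * s) by apply: ln_ge0; lra.
have L2 : 0 <= ln Y by apply: ln_ge0; lra.
have L3 : ln (2 * l * s) < 2 * l * s by exact: ln_sublinear.
have L4 : ln Y < Y by exact: ln_sublinear.
have L5 : `|ln (2 * l * s * Y * A)| <= 3 * Y.
  by rewrite lnT ler_norml; apply/andP; split; lra.
have T0 : 0 < 2 * l * s * Y * A by rewrite !mulr_gt0.
rewrite normrM (gtr0_norm T0).
have L6 : E * (2 * l * s * Y * A * `|ln (2 * l * s * Y * A)|) <=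
   (l * Y * A) * (6 * (E * (q * Y))).
  have -> : E * (2 * l * s * Y * A * `|ln (2 * l * s * Y * A)|) =
    (l * Y * A) * (2 * (E * (s * `|ln (2 * l * s * Y * A)|))) by ring.
  rewrite ler_pM2l//.
  have : s * `|ln (2 * l * s * Y * A)| <= q * (3 * Y) by apply: ler_pM => //; lra.
  move=> /(ler_wpM2l E0); lra.
apply: (@le_lt_trans _ _ ((l * Y * A) * (4 * l * (1 - Y) * q + 2 + 6 * (E * (q * Y))))).
  have -> : (l * Y * A) * (4 * l * (1 - Y) * q + 2 + 6 * (E * (q * Y))) =
     4 * (l ^+ 2 * Y * (1 - Y) * A) * q + 2 * (l * Y * A) +
     (l * Y * A) * (6 * (E * (q * Y))) by ring.
  by rewrite lerD2l.
rewrite pmulr_rlt0//.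
have qY : 2 <= q * Y by rewrite -[2]mul1r ler_pM//; lra.
have : 4 * l * (1 - Y) * q <= - (2 * l * (q * Y)).
  have -> : - (2 * l * (q * Y)) = 4 * l * (- (Y / 2)) * q by field.
  rewrite ler_pM2r// ler_pM2l; lra.
have EqY : 0 <= E * (q * Y) by rewrite mulr_ge0//; lra.
have -> : 2 * l * (q * Y) = 8 * (E * (q * Y)) + 6 * (q * Y) by rewrite /l; ring.
lra.
Qed.

End MaximumPrinciple.

(** * Patching with an eikonal function *)

Section Patching.
Context {R : realType} {T : Type}.
Variables (B : T -> T -> Prop) (I : set T) (V : T -> R) (g : R) (N : nat).
Hypothesis Bsym : forall x y, B x y -> B y x.
Hypothesis g0 : 0 <= g.
Hypothesis V_super : forall x, I x -> exists2 z, B x z &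
  forall y, B x y -> V z <= V y /\ V y + V z <= 2 * V x.
Hypothesis exit : forall x, exists (path : nat -> T) (k : nat),
  [/\ (k <= N)%N, path 0%N = x, ~ I (path k) & forall i, B (path i) (path i.+1)].

Let steep x : Prop := ~ I x \/ exists2 z, B x z & V z + g <= V x.

(* Total price of a chain from x, through flat points, to a steep one: every
   step costs g, and stopping at y costs V y. *)
Inductive cost : T -> R -> Prop :=
| cost_steep x : steep x -> cost x (V x)
| cost_step x y c : ~ steep x -> B x y -> cost y c -> cost x (c + g).

(** A discrete eikonal function of slope [g] on the flat points, with the values of V at the steep
    ones. Later [B x y] means that y lies in the r-ball about x, and [I] consists of the points
    whose 2r-ball lies in the domain. *)
Definition slope_patch x : R := inf [set c | cost x c].

Let flat_I x : ~ steep x -> I x.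
Proof. by move=> ns; apply: contrapT => nI; apply: ns; left. Qed.

Let flat_lt x z : ~ steep x -> B x z -> V x < V z + g.
Proof.
move=> ns xz; rewrite ltNge; apply/negP => h.
by apply: ns; right; exists z.
Qed.

(** By superharmonicity no neighbour rises by more than the drop to the lowest neighbour, which is
    below [g] at a flat point. *)
Let flat_le x y : ~ steep x -> B x y -> V y <= V x + g.
Proof.
move=> ns xy; have [z xz hz] := V_super (flat_I ns).
have [_] := hz y xy; have := flat_lt ns xz; lra.
Qed.

(** Each flat step lowers V by less than the [g] it costs. *)
Let cost_ge x c : cost x c -> V x <= c.
Proof.
elim=> [//|{}x y {}c ns xy _ IH].
have := flat_lt ns xy; lra.
Qed.

Let cost_flat x c : cost x c -> ~ steep x ->
  exists y c', [/\ c = c' + g, B x y & cost y c'].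
Proof. by case=> [//|{}x y {}c _ xy yc _]; exists y, c. Qed.

(** Follow the exit path up to its first steep point: each step costs [g] and raises V by at most
    another [g], hence the factor 2. *)
Let cost_exists x : exists2 c, cost x c & c <= V x + 2 * g *+ N.
Proof.
have [path [k [kN p0 pk pB]]] := exit x.
suff [c xc h] : exists2 c, cost x c & c <= V x + 2 * g *+ k.
  by exists c => //; apply: le_trans h _; rewrite lerD2l ler_wpMn2l// mulr_ge0.
rewrite -p0; elim: k path {kN p0} pk pB => [|k IH] path pk pB.
  by exists (V (path 0%N)); [apply: cost_steep; left | rewrite mulr0n addr0].
have [st|st] := pselect (steep (path 0%N)).
  by exists (V (path 0%N)); [exact: cost_steep | rewrite lerDl mulrn_wge0// mulr_ge0].
have [c yc h] := IH (fun i => path i.+1) pk (fun i => pB i.+1).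
exists (c + g); first exact: cost_step st (pB 0%N) yc.
by have := flat_le st (pB 0%N); rewrite mulrS; lra.
Qed.

Let slope_patch_le_cost x c : cost x c -> slope_patch x <= c.
Proof.
by move=> xc; apply: ge_inf => //; exists (V x) => d; exact: cost_ge.
Qed.

Let le_slope_patch x m : (forall c, cost x c -> m <= c) -> m <= slope_patch x.
Proof.
move=> h; apply: lb_le_inf; last exact: h.
by have [c xc _] := cost_exists x; exists c.
Qed.

Lemma slope_patch_ge x : V x <= slope_patch x.
Proof. by apply: le_slope_patch => c; exact: cost_ge. Qed.

Lemma slope_patch_le x : slope_patch x <= V x + 2 * g *+ N.
Proof.
by have [c xc h] := cost_exists x; apply: le_trans h; exact: slope_patch_le_cost.
Qed.

Let slope_patch_steep x : steep x -> slope_patch x = V x.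
Proof.
move=> sx; apply/eqP; rewrite eq_le slope_patch_ge andbT.
exact: slope_patch_le_cost (cost_steep sx).
Qed.

Lemma slope_patch_exterior x : ~ I x -> slope_patch x = V x.
Proof. by move=> nI; apply: slope_patch_steep; left. Qed.

(** Superharmonicity with an explicit slope: s is [g] at a flat point and the drop of V to its
    lowest neighbour at a steep point. The slack eta is there because the infimum over chains need
    not be known to be attained. *)
Lemma slope_patch_slope x : I x -> exists s, [/\ g <= s,
  forall y, B x y -> slope_patch y <= slope_patch x + s &
  forall eta, 0 < eta -> exists2 z, B x z & slope_patch z <= slope_patch x - s + eta].
Proof.
move=> Ix; have [sx|sx] := pselect (steep x); last first.
  exists g; split=> // [y xy|eta eta0].
    have [sy|sy] := pselect (steep y).
      by rewrite (slope_patch_steep sy); have := flat_le sx xy; have := slope_patch_ge x; lra.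
    rewrite -lerBlDr; apply: le_slope_patch => c xc; rewrite lerBlDr.
    exact: slope_patch_le_cost (cost_step sy (Bsym xy) xc).
  have [|c xc hc] := @inf_adherent _ [set c | cost x c] eta eta0.
    split; first by have [c xc _] := cost_exists x; exists c.
    by exists (V x) => c; exact: cost_ge.
  have [y [c' [cE xy yc]]] := cost_flat xc sx.
  by exists y => //; have := slope_patch_le_cost yc; rewrite cE in hc; lra.
case: (sx) => [//|[z' xz' hz']].
have [z xz hz] := V_super Ix.
have zz' := (hz z' xz').1.
exists (V x - V z); split.
- lra.
- move=> y xy; rewrite (slope_patch_steep sx).
  have [sy|sy] := pselect (steep y).
    by rewrite (slope_patch_steep sy); have := (hz y xy).2; lra.
  have := slope_patch_le_cost (cost_step sy (Bsym xy) (cost_steep sx)); lra.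
(* Steepest descent does not flatten: from [z] the drop of V is at least the drop from x. So z is
   steep, or outside [I], and the patch leaves V z unchanged. *)
- move=> eta eta0; exists z => //; rewrite (slope_patch_steep sx) slope_patch_steep; first lra.
  have [Iz|nIz] := pselect (I z); last by left.
  right; have [z2 zz2 hz2] := V_super Iz; exists z2 => //.
  by have := (hz2 x (Bsym xz)).2; lra.
Qed.

End Patching.

(** * Comparison at a small scale *)

Section Segment.
Context {R : realType} {n : nat}.
Implicit Types (x y z w : 'rV[R]_n) (Omega : set 'rV[R]_n).

Lemma segment_meets_frontier Omega x y : open Omega -> closure Omega x -> ~ Omega y ->
  exists2 z, frontier Omega z & enorm (z - x) <= enorm (y - x).
Proof.
move=> oO cx nOy; apply: contrapT => nex.
pose path (t : R) := x + t *: (y - x).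
have cpath : continuous path.
  move=> t; apply: cvgD; first exact: cvg_cst.
  by apply: cvgZr_tmp; exact: cvg_id.
have pathP t : t \in `[0, 1] -> closure Omega (path t) -> Omega (path t).
  rewrite in_itv /= => /andP[t0 t1] ct; apply: closure_not_frontier => // ft.
  apply: nex; exists (path t) => //.
  by rewrite /path addrC addKr enormZ ger0_norm// ler_piMl// enorm_ge0.
pose A : set R := [set t | t \in `[0, 1] /\ Omega (path t)].
(* If the segment misses the frontier, the times spent in [Omega] are also the times spent in its
   closure: a clopen subset of [0, 1]. *)
have : A = `[(0 : R), 1]%classic.
  apply: (@segment_connected R 0 1).
  - exists 0; split; first by rewrite in_itv /= lexx ler01.
    apply: pathP; first by rewrite in_itv /= lexx ler01.
    by rewrite /path scale0r addr0.
  - exists (path @^-1` Omega); first by apply: open_comp => // t _; exact: cpath.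
    by apply/seteqP; split => t [].
  - exists (path @^-1` closure Omega).
      by apply: preimage_closed => [t _|]; [exact: cpath | exact: closed_closure].
    apply/seteqP; split=> t [t01 h]; split=> //; first exact: subset_closure.
    exact: pathP.
move=> /seteqP[_ /(_ 1)]; case; first by rewrite /= in_itv /= ler01 lexx.
by move=> _; rewrite /path scale1r addrC subrK.
Qed.

End Segment.

Section EpsComparison.
Context {R : realType} {n : nat}.
Implicit Types (x y z w : 'rV[R]_n).
Variables (Omega : set 'rV[R]_n) (D : R).
Hypothesis n0 : (0 < n)%N.
Hypothesis oO : open Omega.
Hypothesis cO : compact (closure Omega).
Hypothesis OD : forall x y, Omega x -> Omega y -> enorm (x - y) <= D.

Lemma ball_sup (u : 'rV[R]_n -> R) (r : R) : 0 <= r -> {within closure Omega, continuous u} ->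
  exists U : 'rV[R]_n -> R, forall x, closure Omega x ->
    (forall y, closure Omega y -> eball x r y -> u y <= U x) /\
    (exists2 y, closure Omega y /\ eball x r y & U x = u y).
Proof.
move=> r0 uc.
have H x : exists m : R, closure Omega x ->
    (forall y, closure Omega y -> eball x r y -> u y <= m) /\
    (exists2 y, closure Omega y /\ eball x r y & m = u y).
  have [cx|] := pselect (closure Omega x); last by exists 0.
  have cI : compact (closure Omega `&` eball x r).
    by apply: compact_closedI => //; exact: closed_eball.
  have [y [cy xy] ymax] : exists2 y, (closure Omega `&` eball x r) y &
      forall t, (closure Omega `&` eball x r) t -> u t <= u y.
    apply: compact_attains_max => //.
      by exists x; split => //; exact: eball_center.
    by apply: continuous_subspaceW uc => t [].
  exists (u y) => _; split; last by exists y.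
  by move=> t ct xt; apply: ymax.
by have [U HU] := choice H; exists U.
Qed.

Lemma eball_midpoint x w (r : R) : eball x (2 * r) w ->
  exists2 z, eball x r z & eball z r w.
Proof.
rewrite /eball /= => xw; exists (x + 2^-1 *: (w - x)).
  by rewrite (addrC x) addrK enormZ ger0_norm ?invr_ge0//; lra.
have -> : w - (x + 2^-1 *: (w - x)) = 2^-1 *: (w - x).
  by rewrite opprD addrA -{1}(scale1r (w - x)) -scalerBl; congr (_ *: _); field.
by rewrite enormZ ger0_norm ?invr_ge0//; lra.
Qed.

(* That is, rho |-> max over B_rho(x) is midpoint convex on [0, 2 r]. *)
Lemma ball_max_convex (w : 'rV[R]_n -> R) (M : R) x y0 y1 (r : R) :
  radial_sub 0 Omega w -> {within closure Omega, continuous w} ->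
  (forall y, Omega y -> w y <= M) -> 0 < r -> eball x (2 * r) `<=` Omega ->
  eball x r y0 -> (forall y, eball x (2 * r) y -> w y <= w y1) -> eball x (2 * r) y1 ->
  2 * w y0 <= w x + w y1.
Proof.
move=> wsub wc wM r0 xrO xy0 y1max xy1.
apply/ler_addgt0Pr => e e0.
(* [cone_comparison] needs b > 0 even for E = 0. The slope increment 3 b r keeps the cone increasing
   and above w on the sphere; the doubled inequality loses 6 b r^2 = e. *)
pose b : R := e / (6 * r ^+ 2).
have b0 : 0 < b by rewrite divr_gt0// mulr_gt0// exprn_gt0.
have bE : 6 * (b * r ^+ 2) = e by rewrite /b; field; rewrite gt_eqF.
have br0 : 0 < b * r by rewrite mulr_gt0.
have x1 : w x <= w y1 by apply: y1max; apply: eball_center; rewrite mulr_ge0// ltW.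
pose d : R := (w y1 - w x) / (2 * r).
have d0 : 0 <= d by rewrite divr_ge0 ?subr_ge0// mulr_ge0// ltW.
have dE : d * (2 * r) = w y1 - w x by rewrite divfK// mulf_neq0 ?gt_eqF.
move: b d b0 bE br0 d0 dE => b d b0 bE br0 d0 dE.
have := @cone_comparison R n 0 Omega w x (2 * r) (d + 3 * (b * r)) b D M
  (lexx 0) wsub wc OD wM xrO _ _ _ _ y0 _.
set rho := enorm (y0 - x) => hc.
have rr : rho <= r by exact: xy0.
have rho0 : 0 <= rho by exact: enorm_ge0.
have h : w y0 <= w x + (d + 3 * (b * r)) * rho - b / 2 * rho ^+ 2.
  apply: hc.
  - lra.
  - by rewrite mul0r.
  - lra.
  - move=> y yr; apply: (@le_trans _ _ (w y1)); first by apply: y1max; rewrite /eball /= yr.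
    have -> : w x + (d + 3 * (b * r)) * (2 * r) - b / 2 * (2 * r) ^+ 2 =
      w x + d * (2 * r) + 4 * (b * r ^+ 2) by field.
    by rewrite dE (addrC (w x)) subrK lerDl !mulr_ge0 ?(ltW b0) ?(ltW r0).
  - by rewrite /eball /= -/rho; lra.
have h1 : (d + 3 * (b * r)) * rho <= (d + 3 * (b * r)) * r by rewrite ler_wpM2l//; lra.
have h2 : 0 <= b / 2 * rho ^+ 2 by rewrite mulr_ge0 ?sqr_ge0//; lra.
have h3 : (d + 3 * (b * r)) * r = d * (2 * r) / 2 + 3 * (b * r ^+ 2) by field.
by rewrite dE in h3; lra.
Qed.

(* The concave change of variable t - th t^2 turns the slope s into a strict gain
   2 th s^2 of the second difference; this beats the error b r^2 of the cone
   comparison. *)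
Lemma slope_arith (th E1 K r s W t P eta : R) :
  0 < th -> th * (16 * (K + 1)) <= 1 -> 0 <= K -> E1 = th ^+ 3 / 34 ->
  0 < r -> r <= 1 -> th * r <= s -> s <= 3 * (K + 1) -> `|W| <= K + 1 ->
  eta = th ^+ 3 * r ^+ 2 / 8 ->
  P = s * (1 - 2 * th * W) - th * s ^+ 2 ->
  s * (1 - 2 * th * W) + th * s ^+ 2 - 3 * eta <= t -> t <= 2 * K ->
  [/\ 0 < t, 2 * E1 * (t ^+ 2 + r ^+ 2) < t &
      t + P + eta <= 2 * t - 2 * E1 * (t ^+ 2 + r ^+ 2)].
Proof.
move=> th0 thK K0 E1E r0 r1 rs sK WK etaE PE tN tK.
have thK' : 0 <= th * K by rewrite mulr_ge0// ltW.
have th1 : th <= 1 / 16 by lra.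
have s0 : 0 < s by apply: lt_le_trans rs; exact: mulr_gt0.
have th20 : 0 < th ^+ 2 by rewrite exprn_gt0.
have th2 : th ^+ 2 <= 1 / 16.
  rewrite expr2; have : th * th <= 1 / 16 * 1 by apply: ler_pM; lra.
  lra.
have thW : `|th * W| <= 1 / 16.
  rewrite normrM gtr0_norm//; have : th * `|W| <= th * (K + 1) by rewrite ler_pM2l.
  lra.
have thWs : `|s * (th * W)| <= s / 16.
  rewrite normrM gtr0_norm//.
  have : s * `|th * W| <= s * (1 / 16) by rewrite ler_pM2l.
  lra.
have ths : th * s ^+ 2 <= s * (3 / 16).
  have -> : th * s ^+ 2 = s * (th * s) by ring.
  rewrite ler_pM2l//; have : th * s <= th * (3 * (K + 1)) by rewrite ler_pM2l.
  lra.
have ths0 : 0 < th * s ^+ 2 by rewrite mulr_gt0// exprn_gt0.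
have eta0 : 0 < eta by rewrite etaE divr_gt0// mulr_gt0// exprn_gt0.
have eta1 : eta <= th * s ^+ 2 / 8.
  have -> : eta = th * (th * r) ^+ 2 / 8 by rewrite etaE; field.
  rewrite ler_pM2r ?invr_gt0// ler_pM2l// ler_pXn2r ?nnegrE ?(ltW s0)//.
  by rewrite mulr_ge0 ?(ltW th0) ?(ltW r0).
have E10 : 0 < E1 by rewrite E1E divr_gt0// exprn_gt0.
have r2 : 2 * E1 * r ^+ 2 <= th * s ^+ 2 / 17.
  have -> : 2 * E1 * r ^+ 2 = th * (th * r) ^+ 2 / 17 by rewrite E1E; field.
  rewrite ler_pM2r ?invr_gt0// ler_pM2l// ler_pXn2r ?nnegrE ?(ltW s0)//.
  by rewrite mulr_ge0 ?(ltW th0) ?(ltW r0).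
move: thW thWs; rewrite !ler_norml => /andP[_ _] /andP[W1 W2].
have t0 : s / 2 <= t by lra.
have tp : 0 < t by lra.
have EK : 2 * E1 * t ^+ 2 <= t / 8.
  have -> : 2 * E1 * t ^+ 2 = t * (2 * E1 * t) by ring.
  rewrite ler_pM2l//.
  have : 2 * E1 * t <= 2 * E1 * (2 * K) by rewrite ler_pM2l// mulr_gt0.
  have : th ^+ 2 * (th * K) <= 1 / 16 * 1 by apply: ler_pM; lra.
  rewrite E1E; lra.
split=> //; first lra.
(* If t > 4 s, then P <= 9 s / 8 leaves ample room. Otherwise the error is quadratic in s and is
   absorbed by the gain 2 th s^2. *)
have [t4|t4] := leP t (4 * s); last lra.
have : 2 * E1 * t ^+ 2 <= th * s ^+ 2 / 17.
  have -> : th * s ^+ 2 / 17 = th * (1 / 16) / 17 * (4 * s) ^+ 2 by field.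
  have : t ^+ 2 <= (4 * s) ^+ 2 by rewrite ler_pXn2r ?nnegrE//; lra.
  apply: ler_pM; [|exact: sqr_ge0|]; first by rewrite mulr_ge0// ltW.
  have : th * th ^+ 2 <= th * (1 / 16) by rewrite ler_pM2l.
  rewrite E1E exprS; lra.
lra.
Qed.

(** The cone of slope a = t / r with b = E1 (a^2 + 1) has exactly the assumed bound as its value at
    radius 2 r, as b r^2 = E1 (t^2 + r^2). At radius up to r it stays strictly below u x + t. *)
Lemma cone_midpoint (E E1 K r t : R) (u : 'rV[R]_n -> R) x :
  0 <= E -> E < E1 -> 0 < r -> 0 < t -> 2 * E1 * (t ^+ 2 + r ^+ 2) < t ->
  radial_sub E Omega u -> {within closure Omega, continuous u} ->
  (forall y, Omega y -> u y <= K) -> eball x (2 * r) `<=` Omega ->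
  (forall w, eball x (2 * r) w -> u w <= u x + 2 * t - 2 * E1 * (t ^+ 2 + r ^+ 2)) ->
  forall y, eball x r y -> u y < u x + t.
Proof.
move=> E0 EE1 r0 t0 A1 usub uc uM Ix uw y xy.
pose a := t / r; pose b := E1 * (a ^+ 2 + 1).
have ar : a * r = t by rewrite divfK// gt_eqF.
have br : b * r ^+ 2 = E1 * (t ^+ 2 + r ^+ 2) by rewrite /b -ar; ring.
have a0 : 0 < a by exact: divr_gt0.
have E10 : 0 < E1 by exact: le_lt_trans E0 EE1.
have b0 : 0 < b by rewrite mulr_gt0// ltr_wpDl// sqr_ge0.
have Eb : E * (a ^+ 2 + 1) < b by rewrite ltr_pM2r// ltr_wpDl// sqr_ge0.
move: a b ar br a0 b0 Eb => a b ar br a0 b0 Eb.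
have b2 : b * (2 * r) < a.
  rewrite -(ltr_pM2r r0) ar.
  have -> : b * (2 * r) * r = 2 * (b * r ^+ 2) by ring.
  by rewrite br mulrA.
have sph w : enorm (w - x) = 2 * r -> u w <= u x + a * (2 * r) - b / 2 * (2 * r) ^+ 2.
  move=> wr; have -> : u x + a * (2 * r) - b / 2 * (2 * r) ^+ 2 =
    u x + 2 * (a * r) - 2 * (b * r ^+ 2) by field.
  by rewrite ar br mulrA; apply: uw; rewrite /eball /= wr.
have xy2 : eball x (2 * r) y by move: xy; rewrite /eball /=; lra.
apply: le_lt_trans (cone_comparison E0 usub uc OD uM Ix a0 Eb b2 sph xy2) _.
set rho := enorm (y - x).
have rr : rho <= r by exact: xy.
have arho : a * rho <= t by rewrite -ar ler_pM2l.
have : 0 <= rho by exact: enorm_ge0.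
rewrite le_eqVlt => /orP[/eqP <-|rho0]; first by rewrite mulr0 expr0n mulr0; lra.
have : 0 < b / 2 * rho ^+ 2 by apply: mulr_gt0; [exact: divr_gt0 | exact: exprn_gt0].
lra.
Qed.

(** G(c) = c - th c^2 is increasing on the range in question. A rise of W by s becomes a rise s (1 -
    2 th W) - th s^2 and a drop by s the larger drop s (1 - 2 th W) + th s^2; the slack eta at most
    doubles. *)
Lemma concave_step (th K W s eta c : R) : 0 < th -> th * (16 * (K + 1)) <= 1 ->
  0 <= K -> 0 <= s -> 0 < eta -> eta <= 1 ->
  - (K + 1) <= W <= K + 1 -> - (K + 1) <= c <= K + 1 -> s <= 3 * (K + 1) ->
  (c <= W + s -> c - th * c ^+ 2 <=
     W - th * W ^+ 2 + (s * (1 - 2 * th * W) - th * s ^+ 2)) /\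
  (c <= W - s + eta -> c - th * c ^+ 2 <=
     W - th * W ^+ 2 - (s * (1 - 2 * th * W) + th * s ^+ 2) + 2 * eta).
Proof.
move=> th0 thK K0 s0 eta0 eta1 /andP[W1 W2] /andP[c1 c2] s3.
pose G c := c - th * c ^+ 2.
have Gmono d d' : d <= d' -> d + d' <= 6 * (K + 1) -> G d <= G d'.
  move=> dd' dK; rewrite -subr_ge0.
  have -> : G d' - G d = (d' - d) * (1 - th * (d + d')) by rewrite /G; ring.
  rewrite mulr_ge0 ?subr_ge0//.
  have : th * (d + d') <= th * (6 * (K + 1)) by rewrite ler_pM2l.
  have : 0 <= th * K by rewrite mulr_ge0// ltW.
  lra.
split=> cW; apply: le_trans (Gmono _ _ cW _) _; first lra.
- by rewrite le_eqVlt; apply/orP; left; apply/eqP; rewrite /G; ring.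
- lra.
have -> : G (W - s + eta) = W - th * W ^+ 2 - (s * (1 - 2 * th * W) + th * s ^+ 2) +
    eta * (1 - th * (2 * (W - s) + eta)) by rewrite /G; ring.
rewrite lerD2l mulrC ler_pM2r//.
have : th * (- (8 * (K + 1))) <= th * (2 * (W - s) + eta) by rewrite ler_pM2l//; lra.
have : 0 <= th * K by rewrite mulr_ge0// ltW.
lra.
Qed.

(** [W] patches V, the minimum of v over r-balls, with slope th r per step. A straight walk leaves
    [Omega] after about D / r steps, so the patch adds at most 2 th (D + 1). *)
Lemma steep_supersolution (K th r : R) (v : 'rV[R]_n -> R) :
  0 <= K -> 0 <= D -> 0 < th -> 2 * (th * (D + 1)) <= 1 ->
  radial_sub 0 Omega (fun x => - v x) -> {within closure Omega, continuous v} ->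
  (forall x, closure Omega x -> `|v x| <= K) -> 0 < r -> r <= 1 ->
  exists W : 'rV[R]_n -> R,
  [/\ forall x, closure Omega x -> - (K + 1) <= W x <= K + 1,
      forall x, Omega x -> W x <= v x + 2 * (th * (D + 1)),
      forall x, closure Omega x -> ~ (eball x (2 * r) `<=` Omega) ->
        exists2 y, closure Omega y /\ eball x r y & W x = v y &
      forall x, eball x (2 * r) `<=` Omega -> exists s, [/\ th * r <= s,
        forall y, eball x r y -> W y <= W x + s &
        forall eta, 0 < eta -> exists2 z, eball x r z & W z <= W x - s + eta]].
Proof.
move=> K0 D0 th0 thD vsub vc vK r0 r1.
have vcN : {within closure Omega, continuous (fun x => - v x)}.
  by move=> x; apply: continuousN; exact: vc.
have [V' HV'] := ball_sup (ltW r0) vcN.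
pose V x := - V' x.
have Vle x y : closure Omega x -> closure Omega y -> eball x r y -> V x <= v y.
  by move=> cx cy xy; have := (HV' x cx).1 y cy xy; rewrite /V lerNl.
have Vex x : closure Omega x -> exists2 y, closure Omega y /\ eball x r y & V x = v y.
  by move=> /HV'[_ [y yP h]]; exists y => //; rewrite /V h opprK.
pose I : set 'rV[R]_n := [set x | eball x (2 * r) `<=` Omega].
pose B x y := eball x r y.
have Bsym x y : B x y -> B y x by exact: eball_sym.
have ball2 x y z : eball x r y -> eball y r z -> eball x (2 * r) z.
  rewrite /eball /= => xy yz; apply: le_trans (enorm_triangle y _ _) _; lra.
have IO x : I x -> Omega x by apply; apply: eball_center; lra.
have IB x y : I x -> B x y -> Omega y.
  by move=> Ix xy; apply/Ix/(ball2 _ _ _ xy)/eball_center/ltW.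
have cl := @subset_closure _ Omega.
have V_super x : I x -> exists2 z, B x z & forall y, B x y -> V z <= V y /\ V y + V z <= 2 * V x.
  move=> Ix; have Ox := IO x Ix.
  have [y1 xy1 y1max] : exists2 y1, eball x (2 * r) y1 &
      forall y, eball x (2 * r) y -> - v y <= - v y1.
    apply: (@compact_attains_max _ _ _ (fun x => - v x)).
    - exact: compact_eball.
    - by exists x; apply: eball_center; lra.
    - by apply: continuous_subspaceW vcN => y /Ix; exact: cl.
  (* The midpoint of x and a minimum point y1 of v on the 2r-ball sees y1, hence minimizes V over
     the r-ball about x. Convexity of ball maxima of -v gives the other inequality. *)
  have [z xz zy1] := eball_midpoint xy1.
  have Oz := IB x z Ix xz.
  have Vz : V z <= v y1 by apply: Vle => //; apply: cl => //; exact: Ix.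
  have [y0 [cy0 xy0] Vx] := Vex x (cl _ Ox).
  have vM y : Omega y -> - v y <= K.
    by move=> /cl /vK; rewrite ler_norml lerNl => /andP[].
  have := ball_max_convex vsub vcN vM r0 Ix xy0 y1max xy1; rewrite -Vx => cvx.
  exists z => // y xy; have Oy := IB x y Ix xy.
  have [y' [cy' yy'] Vy] := Vex y (cl _ Oy).
  have := y1max y' (ball2 _ _ _ xy yy').
  have := Vle y x (cl _ Oy) (cl _ Ox) (Bsym _ _ xy).
  by rewrite -Vy; split; lra.
(* The successor makes N r exceed D strictly; the overshoot is at most r <= 1. *)
have [N [DN ND]] : exists N : nat, D < N%:R * r /\ N%:R * r <= D + 1.
  have h := truncn_itv (divr_ge0 D0 (ltW r0)).
  exists (Num.truncn (D / r)).+1; move: h => /andP[h1 h2].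
  rewrite -ltr_pdivrMr//; split => //.
  by rewrite -natr1 mulrDl mul1r; move: h1; rewrite ler_pdivlMr//; lra.
have exit x : exists (path : nat -> 'rV[R]_n) (k : nat),
    [/\ (k <= N)%N, path 0%N = x, ~ I (path k) & forall i, B (path i) (path i.+1)].
  pose e : 'rV[R]_n := delta_mx 0 (Ordinal n0).
  have e1 : enorm e = 1 by rewrite /enorm inner_delta /e mxE !eqxx sqrtr1.
  pose path (i : nat) := x + (i%:R * r) *: e.
  have p0 : path 0%N = x by rewrite /path mul0r scale0r addr0.
  have pB i : B (path i) (path i.+1).
    rewrite /B /eball /= /path opprD addrACA subrr add0r -scalerBl -natr1.
    by rewrite mulrDl mul1r (addrC _ r) addrK enormZ e1 mulr1 gtr0_norm.
  have [I0|nI0] := pselect (I (path 0%N)); last by exists path, 0%N.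
  exists path, N; split=> // IN.
  have := OD (IO _ IN) (IO _ I0); rewrite p0 /path (addrC x) addrK enormZ e1 mulr1.
  by rewrite ger0_norm ?mulr_ge0 ?(ltW r0)// leNgt DN.
have g0 : 0 <= th * r by rewrite mulr_ge0 ?(ltW th0) ?(ltW r0).
pose W := slope_patch B I V (th * r).
have WV x : V x <= W x by exact: slope_patch_ge.
have VW x : W x <= V x + 2 * (th * (D + 1)).
  apply: le_trans (slope_patch_le g0 V_super exit x) _; rewrite lerD2l.
  by rewrite -mulr_natr -!mulrA ler_pM2l// ler_pM2l// mulrC.
exists W; split.
- move=> x cx; have [y [cy _] Vy] := Vex x cx; have := vK y cy.
  have := WV x; have := VW x; rewrite Vy ler_norml; lra.
- move=> x Ox; apply: le_trans (VW x) _; rewrite lerD2r.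
  by apply: Vle; [exact: cl | exact: cl | exact/eball_center/ltW].
- move=> x cx nIx; have [y yP Vy] := Vex x cx; exists y => //.
  by rewrite /W (slope_patch_exterior g0 V_super exit).
- by move=> x Ix; exact: (slope_patch_slope Bsym g0 V_super exit).
Qed.

(** Some frontier point lies within 2 r of x, hence within 3 r of y and y'; there u <= v. *)
Lemma near_frontier (r om : R) (u v : 'rV[R]_n -> R) x y y' :
  (forall x y, closure Omega x -> closure Omega y -> enorm (x - y) <= 3 * r ->
     `|u x - u y| <= om) ->
  (forall x y, closure Omega x -> closure Omega y -> enorm (x - y) <= 3 * r ->
     `|v x - v y| <= om) ->
  (forall x, frontier Omega x -> u x <= v x) ->
  closure Omega x -> ~ (eball x (2 * r) `<=` Omega) ->
  closure Omega y -> eball x r y -> closure Omega y' -> eball x r y' ->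
  u y <= v y' + 2 * om.
Proof.
move=> uom vom uv cx nIx cy xy cy' xy'.
have [w xw nOw] : exists2 w, eball x (2 * r) w & ~ Omega w.
  apply: contrapT => h; apply: nIx => w xw; apply: contrapT => nOw.
  by apply: h; exists w.
have [z fz zx] := segment_meets_frontier oO cx nOw.
have xz : enorm (x - z) <= 2 * r by rewrite enorm_distC; exact: le_trans xw.
have cz : closure Omega z by case: fz.
have near3 t : eball x r t -> enorm (t - z) <= 3 * r.
  rewrite /eball /= => xt; apply: le_trans (enorm_triangle x _ _) _; lra.
have := uom _ _ cy cz (near3 _ xy); have := vom _ _ cy' cz (near3 _ xy').
have := uv z fz; rewrite !ler_norml; lra.
Qed.

(** At an almost maximal point x of [F] the increments of U are at most those of W - th W^2, up to
    eta. The low neighbour z gives a lower bound for t = U x - u x, because u x <= U z; the other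
    neighbours bound u on the 2r-ball. By [slope_arith] and [cone_midpoint] the maximum U x of u on
    the r-ball would be below u x + t = U x. *)
Lemma eps_comparison (E K th r om : R) (u v : 'rV[R]_n -> R) :
  0 <= E -> 0 <= K -> 0 < th -> th * (16 * (K + 1)) <= 1 -> 2 * (th * (D + 1)) <= 1 ->
  E < th ^+ 3 / 34 ->
  radial_sub E Omega u -> radial_sub 0 Omega (fun x => - v x) ->
  {within closure Omega, continuous u} -> {within closure Omega, continuous v} ->
  (forall x, closure Omega x -> `|u x| <= K) -> (forall x, closure Omega x -> `|v x| <= K) ->
  0 < r -> r <= 1 ->
  (forall x y, closure Omega x -> closure Omega y -> enorm (x - y) <= 3 * r ->
     `|u x - u y| <= om) ->
  (forall x y, closure Omega x -> closure Omega y -> enorm (x - y) <= 3 * r ->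
     `|v x - v y| <= om) ->
  (forall x, frontier Omega x -> u x <= v x) ->
  forall x, Omega x -> u x - v x <= 2 * om + th * ((K + 1) ^+ 2 + 2 * (D + 1)).
Proof.
move=> E0 K0 th0 thK thD Eth usub vsub uc vc uK vK r0 r1 uom vom uv x1 Ox1.
rewrite leNgt; apply/negP => bad.
have D0 : 0 <= D by apply: le_trans (OD Ox1 Ox1); exact: enorm_ge0.
have [U HU] := ball_sup (ltW r0) uc.
have [W [WK Wv Wext Wslope]] := steep_supersolution K0 D0 th0 thD vsub vc vK r0 r1.
have cl := @subset_closure _ Omega.
have th1 : th <= 1 by have := mulr_ge0 (ltW th0) K0; lra.
pose F x := U x - (W x - th * W x ^+ 2).
pose m := 2 * om + th * (K + 1) ^+ 2.
have W2 x : closure Omega x -> th * W x ^+ 2 <= th * (K + 1) ^+ 2.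
  move=> /WK; rewrite -ler_norml => Wx.
  by rewrite ler_pM2l// -real_normK ?num_real// ler_pXn2r ?nnegrE ?addr_ge0.
have Fext x : closure Omega x -> ~ (eball x (2 * r) `<=` Omega) -> F x <= m.
  move=> cx nIx.
  have [_ [yu [cyu xyu] Uyu]] := HU x cx.
  have [yv [cyv xyv] Wyv] := Wext x cx nIx.
  have := near_frontier uom vom uv cx nIx cyu xyu cyv xyv.
  have := W2 x cx; rewrite /F /m Uyu Wyv; clear -n Omega D; lra.
have Fx1 : m < F x1.
  have Uu := (HU x1 (cl _ Ox1)).1 x1 (cl _ Ox1) (eball_center _ (ltW r0)).
  have Wx1 := Wv x1 Ox1; have : 0 <= th * W x1 ^+ 2 by rewrite mulr_ge0 ?sqr_ge0 ?(ltW th0).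
  by rewrite /F /m; move: bad Uu Wx1; clear -n Omega D; lra.
(* Small against the gain: th s^2 >= th^3 r^2 = 8 eta. *)
pose eta := th ^+ 3 * r ^+ 2 / 8.
have eta0 : 0 < eta by rewrite divr_gt0// mulr_gt0// exprn_gt0.
have eta1 : eta <= 1.
  rewrite /eta ler_pdivrMr// mul1r (@le_trans _ _ (1 * 1))//; last by rewrite mulr1 ler1n.
  by apply: ler_pM; rewrite ?exprn_ge0 ?exprn_ile1 ?(ltW th0) ?(ltW r0).
(* No continuity of [F] is available, so an almost maximal point is taken; the minimum with sup - m
   keeps it above [m], hence away from the boundary. *)
have [x cx [Fmax Fx]] : exists2 x, closure Omega x &
    (forall y, closure Omega y -> F y <= F x + eta) /\ m < F x.
  pose FF := [set F x | x in closure Omega].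
  have hF : has_sup FF.
    split; first by exists (F x1), x1 => //; exact: cl.
    exists (K + (K + 1) + th * (K + 1) ^+ 2) => _ [y cy <-].
    have [_ [yu [cyu _] Uyu]] := HU y cy.
    have := uK yu cyu; have := WK y cy; have := W2 y cy.
    rewrite /F Uyu ler_norml; clear -n Omega D; lra.
  have supF y : closure Omega y -> F y <= sup FF.
    by move=> cy; apply: ub_le_sup; [exact: hF.2 | exists y].
  have e0 : 0 < Num.min eta (sup FF - m).
    by rewrite lt_min eta0 subr_gt0; apply: lt_le_trans Fx1 _; apply: supF; exact: cl.
  have [_ [x cx <-]] := sup_adherent e0 hF.
  rewrite ltrBlDr -ltrBlDl lt_min => /andP[h1 h2].
  exists x => //; split; last by move: h2; rewrite ltrD2l ltrN2.
  by move=> y /supF Fy; apply: le_trans Fy _; rewrite -lerBlDl ltW.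
have Ix : eball x (2 * r) `<=` Omega.
  by apply: contrapT => nIx; have := Fext x cx nIx; rewrite leNgt Fx.
have IB y : eball x r y -> closure Omega y.
  move=> xy; apply/cl/Ix; move: xy; rewrite /eball /= => /le_trans; apply.
  by rewrite ler_peMl ?(ltW r0) ?ler1n.
have [s [gs Ws Wz]] := Wslope x Ix.
have [z xz hz] := Wz eta eta0.
have WKx := WK x cx; have WKz := WK z (IB z xz).
have s3 : s <= 3 * (K + 1) by move: hz WKx WKz eta1 K0; clear -n Omega D; lra.
have s0 : 0 <= s by apply: le_trans gs; rewrite mulr_ge0 ?(ltW th0) ?(ltW r0).
pose t := U x - u x.
have [_ [y0 [cy0 xy0] Uy0]] := HU x cx.
have t2K : t <= 2 * K.
  have := uK y0 cy0; have := uK x cx; rewrite /t Uy0 !ler_norml; clear -n Omega D; lra.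
pose P := s * (1 - 2 * th * W x) - th * s ^+ 2.
have tN : s * (1 - 2 * th * W x) + th * s ^+ 2 - 3 * eta <= t.
  have h1 : u x <= U z by apply: (HU z (IB z xz)).1 => //; exact: eball_sym.
  have h2 := (concave_step th0 thK K0 s0 eta0 eta1 WKx WKz s3).2 hz.
  have := Fmax z (IB z xz).
  by rewrite /F /t; move: h1 h2; clear -n Omega D; lra.
have uP w : eball x (2 * r) w -> u w <= U x + P + eta.
  move=> xw; have [y xy yw] := eball_midpoint xw.
  have h1 : u w <= U y by apply: (HU y (IB y xy)).1 => //; apply: cl; exact: Ix.
  have h2 := (concave_step th0 thK K0 s0 eta0 eta1 WKx (WK y (IB y xy)) s3).1 (Ws y xy).
  have := Fmax y (IB y xy).
  by rewrite /F /P; move: h1 h2; clear -n Omega D; lra.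
rewrite -ler_norml in WKx.
have [t0 A1 A2] := slope_arith th0 thK K0 erefl r0 r1 gs s3 WKx erefl erefl tN t2K.
have uM y : Omega y -> u y <= K by move=> /cl/uK; rewrite ler_norml => /andP[].
have : u y0 < u x + t.
  apply: (cone_midpoint E0 Eth r0 t0 A1 usub uc uM Ix) => // w /uP.
  by rewrite /P /eta; move: A2; rewrite /t; clear -n Omega D; lra.
by rewrite -Uy0 /t addrC subrK ltxx.
Qed.

End EpsComparison.

(** * Null sets and essential suprema *)

Section Null.
Context {R : realType}.

Definition slab (p q t : R) : R := (p <= t <= q)%R%:R.

Lemma slab_ge0 p q t : 0 <= slab p q t.
Proof. exact: ler0n. Qed.

(** Integrate the pointwise inequality in t, exchanging sum and integral of nonnegative terms. *)
Lemma interval_cover_weighted (c A B : R) (d a b : nat -> R) :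
  0 <= c -> A <= B -> (forall k, 0 <= d k) -> (forall k, a k <= b k) ->
  (forall t : R, ((c * slab A B t)%:E <=
     \sum_(0 <= k <oo) (d k * slab (a k) (b k) t)%:E)%E) ->
  ((c * (B - A))%:E <= \sum_(0 <= k <oo) (d k * (b k - a k))%:E)%E.
Proof.
move=> c0 AB d0 ab H.
have slabE (e p q : R) : (fun t => (e * slab p q t)%:E) =
    (fun t => e%:E * (\1_`[p, q]%classic t)%:E)%E.
  by apply/funext => t; rewrite -EFinM indicE mem_setE in_itv.
have mslab (e p q : R) : measurable_fun setT (fun t : R => e * slab p q t).
  rewrite (_ : (fun _ => _) = (fun t : R => e * \1_`[p, q]%classic t)); last first.
    by apply/funext => t; rewrite indicE mem_setE in_itv.
  by apply: measurable_funM => //; exact: measurable_indic.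
have int_slab (e p q : R) : 0 <= e -> p <= q ->
    (\int[@lebesgue_measure R]_t (e * slab p q t)%:E = (e * (q - p))%:E)%E.
  move=> e0 pq; rewrite slabE ge0_integralZl_EFin//; last first.
    by apply/measurable_EFinP; exact: measurable_indic.
  rewrite integral_indic// setIT /= lebesgue_measure_itv /= lte_fin.
  case: ltP => [_|qp]; first by rewrite -EFinB -EFinM.
  by rewrite mule0 (_ : p = q) ?subrr ?mulr0//; apply/eqP; rewrite eq_le pq.
rewrite -int_slab//.
under eq_eseriesr => k _ do rewrite -int_slab//.
rewrite -integral_nneseries//; last 2 first.
- by move=> k; apply/measurable_EFinP; exact: mslab.
- by move=> k t _; rewrite lee_fin mulr_ge0// slab_ge0.
apply: ge0_le_integral => //.
- by move=> t _; rewrite lee_fin mulr_ge0// slab_ge0.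
- by apply/measurable_EFinP; exact: mslab.
- apply: (ge0_emeasurable_sum (P := xpredT)) => [k t _ _|k _].
    by rewrite lee_fin mulr_ge0// slab_ge0.
  by apply/measurable_EFinP; exact: mslab.
Qed.

(** Countable subadditivity of volume: the covering is an inequality between indicators, which is
    integrated in one coordinate after the other. *)
Lemma box_cover_volume (n : nat) (a0 b0 : 'rV[R]_n) (a b : nat -> 'rV[R]_n) :
  (forall i, a0 0 i <= b0 0 i) -> (forall k i, a k 0 i <= b k 0 i) ->
  box a0 b0 `<=` \bigcup_k box (a k) (b k) ->
  ((\prod_(i < n) (b0 0 i - a0 0 i))%:E <=
     \sum_(0 <= k <oo) (\prod_(i < n) (b k 0 i - a k 0 i))%:E)%E.
Proof.
move=> ab0 ab cov.
(* the volume in the first m coordinates of the section through x *)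
pose vol m (p q x : 'rV[R]_n) : R :=
  \prod_(i < n) (if (i < m)%N then q 0 i - p 0 i else slab (p 0 i) (q 0 i) (x 0 i)).
have vol_ge0 m (p q x : 'rV[R]_n) : (forall i, p 0 i <= q 0 i) -> 0 <= vol m p q x.
  move=> pq; apply: prodr_ge0 => i _.
  by case: ifP => _; [rewrite subr_ge0 | exact: slab_ge0].
suff H m x : (m <= n)%N ->
    ((vol m a0 b0 x)%:E <= \sum_(0 <= k <oo) (vol m (a k) (b k) x)%:E)%E.
  have := H n 0 (leqnn n).
  rewrite /vol; under eq_bigr => i _ do rewrite ltn_ord.
  by under eq_eseriesr => k _ do under eq_bigr => i _ do rewrite ltn_ord.
elim: m x => [|m IH] x mn.
  rewrite /vol /=.
  have [xb|xb] := pselect (box a0 b0 x).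
    have [k _ xk] := cov x xb.
    rewrite big1 ?mulr1//; last by move=> i _; rewrite /slab xb.
    apply: (le_trans _ (nneseries_lim_ge k.+1 _)); last first.
      by move=> j _ _; rewrite lee_fin; have := vol_ge0 0%N _ _ x (ab j).
    rewrite big_nat_recr//= [X in (_ <= _ + X)%E](_ : _ = 1%E); last first.
      by rewrite big1// => i _; rewrite /slab xk.
    rewrite leeDr// sume_ge0// => j _.
    by rewrite lee_fin; have := vol_ge0 0%N _ _ x (ab j).
  rewrite [X in (X%:E <= _)%E](_ : _ = 0).
    by apply: nneseries_ge0 => j _ _; rewrite lee_fin; have := vol_ge0 0%N _ _ x (ab j).
  apply/eqP; apply/prodf_eq0.
  have [i /negP xi] : exists i, ~ (a0 0 i <= x 0 i <= b0 0 i).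
    by apply/existsNP.
  by exists i => //; rewrite /slab (negbTE xi).
pose j := Ordinal mn.
pose rest (p q : 'rV[R]_n) : R := \prod_(i < n | i != j)
  (if (i < m)%N then q 0 i - p 0 i else slab (p 0 i) (q 0 i) (x 0 i)).
have rest_ge0 (p q : 'rV[R]_n) : (forall i, p 0 i <= q 0 i) -> 0 <= rest p q.
  move=> pq; apply: prodr_ge0 => i _.
  by case: ifP => _; [rewrite subr_ge0 | exact: slab_ge0].
pose xt t : 'rV[R]_n := \row_i (if i == j then t else x 0 i).
have volS (p q : 'rV[R]_n) : vol m.+1 p q x = rest p q * (q 0 j - p 0 j).
  rewrite /vol (bigD1 j)//= ltnSn mulrC; congr (_ * _).
  apply: eq_bigr => i ij; rewrite ltnS leq_eqVlt.
  by have -> : (i == m :> nat) = false by apply/negbTE.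
have vol_xt (p q : 'rV[R]_n) t : vol m p q (xt t) = rest p q * slab (p 0 j) (q 0 j) t.
  rewrite /vol (bigD1 j)//= ltnn mulrC !mxE eqxx; congr (_ * _).
  by apply: eq_bigr => i ij; rewrite mxE (negbTE ij).
rewrite volS; under eq_eseriesr => k _ do rewrite volS.
apply: interval_cover_weighted => //; [exact: rest_ge0 | by move=> k; exact: rest_ge0 |].
move=> t; rewrite -vol_xt.
by under eq_eseriesr => k _ do rewrite -vol_xt; apply: IH; exact: ltnW.
Qed.

(** A nonempty open set contains a box of positive volume, which boxes of half that total volume
    cannot cover. *)
Lemma open_lebesgue_null (n : nat) (O : set 'rV[R]_n) :
  open O -> lebesgue_null O -> O = set0.
Proof.
move=> oO null; apply/seteqP; split => // x Ox.
have [e /= e0 he] : nbhs_ball x O by apply/nbhs_ballP; exact: open_nbhs_nbhs.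
pose a := \row_i (x 0 i - e / 2); pose b := \row_i (x 0 i + e / 2).
have abE i : b 0 i - a 0 i = e by rewrite !mxE; field.
have v0 : 0 < \prod_(i < n) (b 0 i - a 0 i).
  by apply: prodr_gt0 => i _; rewrite abE.
have [a' [b' [ab' cov vol]]] := null _ (divr_gt0 v0 (@ltr0n _ 2)).
have /le_trans/(_ vol) : ((\prod_(i < n) (b 0 i - a 0 i))%:E <=
    \sum_(0 <= k <oo) (\prod_(i < n) (b' k 0 i - a' k 0 i))%:E)%E.
  apply: box_cover_volume => //; first by move=> i; rewrite -subr_ge0 abE ltW.
  apply: subset_trans cov => y xy; apply: he.
  rewrite -ball_normE /= (le_lt_trans (y := e / 2))//; last by lra.
  change (mx_norm (x - y) <= e / 2).
  have [->|h] := eqVneq (mx_norm (x - y)) 0; first by rewrite divr_ge0// ltW.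
  have [[k i] /= ->] := mx_norm_neq0 h; rewrite ord1 !mxE.
  by have := xy i; rewrite !mxE ler_distl => /andP[]; lra.
by rewrite lee_fin; lra.
Qed.

End Null.

(** * Essential suprema and pointwise bounds for the data *)

Section EssentialSupremum.
Context {R : realType} {n : nat}.
Implicit Types (x y z : 'rV[R]_n) (Omega : set 'rV[R]_n) (g h : 'rV[R]_n -> R).

(** In positive dimension a one-point box has volume 0; for n = 0 the empty product would be 1. *)
Lemma lebesgue_null0 : (0 < n)%N -> lebesgue_null (set0 : set 'rV[R]_n).
Proof.
move=> n0 e e0; exists (fun=> 0), (fun=> 0); split=> //.
rewrite eseries0 ?lee_fin ?(ltW e0)// => k _ _.
by rewrite (bigD1 (Ordinal n0))//= !mxE subrr mul0r.
Qed.

Lemma Linfty_ge0 Omega g : (0 <= Linfty Omega g)%E.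
Proof. by apply/ereal_infP => _ [M [M0 _] <-]; rewrite lee_fin. Qed.

Lemma Linfty_le Omega g (M : R) : (0 < n)%N -> 0 <= M ->
  (forall x, Omega x -> `|g x| <= M) -> (Linfty Omega g <= M%:E)%E.
Proof.
move=> n0 M0 gM; apply: ereal_inf_lbound; exists M => //; split=> //.
rewrite (_ : mkset _ = set0); first exact: lebesgue_null0.
by apply/seteqP; split=> // x [/gM gx]; rewrite ltNge gx.
Qed.

Lemma Linfty_fin_num Omega g (M : R) : (0 < n)%N -> 0 <= M ->
  (forall x, Omega x -> `|g x| <= M) -> (Linfty Omega g \is a fin_num)%E.
Proof.
move=> n0 M0 gM; rewrite fin_numE gt_eqF ?(lt_le_trans _ (Linfty_ge0 _ _))//=.
by rewrite lt_eqF// (le_lt_trans (Linfty_le n0 M0 gM)) ?ltry.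
Qed.

Lemma Linfty_ext Omega g h : (forall x, Omega x -> g x = h x) ->
  Linfty Omega g = Linfty Omega h.
Proof.
move=> gh; rewrite /Linfty.
have -> // : [set M : R | 0 <= M /\ lebesgue_null [set x | Omega x /\ M < `|g x|]] =
  [set M : R | 0 <= M /\ lebesgue_null [set x | Omega x /\ M < `|h x|]].
apply/funext => M; congr (_ /\ lebesgue_null _).
by apply/seteqP; split=> x /= [Ox]; rewrite gh.
Qed.

(** By continuity {|g| > M} is open, so it is empty as soon as it is null. *)
Lemma le_Linfty Omega g : open Omega ->
  (forall x, Omega x -> {for x, continuous g}) ->
  forall x, Omega x -> (`|g x|%:E <= Linfty Omega g)%E.
Proof.
move=> oO cg x Ox; apply/ereal_infP => _ [M [M0 null] <-].
rewrite lee_fin leNgt; apply/negP => Mg.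
suff oS : open [set x | Omega x /\ M < `|g x|].
  have : [set x | Omega x /\ M < `|g x|] x by [].
  by rewrite (open_lebesgue_null oS null).
rewrite openE => y [Oy My]; near=> t; split; near: t; first exact: open_nbhs_nbhs.
exact: (cvgr_gt _ (cvg_norm (cg y Oy)) _ My).
Unshelve. all: by end_near. Qed.

(** A bound on g comes first because [fine] sends +oo to 0. *)
Lemma fine_Linfty Omega g (M : R) : (0 < n)%N -> open Omega ->
  (forall x, Omega x -> {for x, continuous g}) ->
  (forall x, Omega x -> `|g x| <= M) -> 0 <= M ->
  forall x, Omega x -> `|g x| <= fine (Linfty Omega g).
Proof.
move=> n0 oO cg gM M0 x Ox; rewrite -lee_fin fineK; first exact: le_Linfty.
exact: Linfty_fin_num gM.
Qed.

Lemma compact_bounded_fun (A : set 'rV[R]_n) (u : 'rV[R]_n -> R) :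
  compact A -> {within A, continuous u} ->
  exists2 M, 0 <= M & forall x, A x -> `|u x| <= M.
Proof.
move=> cA uc; have [[x0 Ax0]|A0] := pselect (A !=set0); last first.
  by exists 0 => // x Ax; exfalso; apply: A0; exists x.
have [|x Ax hx] := @compact_attains_max _ _ A (fun x => `|u x|) cA (ex_intro _ x0 Ax0).
  apply/subspace_continuousP => x Ax; apply: cvg_norm.
  by move/subspace_continuousP : uc; exact.
by exists `|u x|.
Qed.

Lemma compact_closure_bounded Omega : bounded_set Omega -> compact (closure Omega).
Proof.
move=> [M [Mr bM]]; apply: bounded_closed_compact; last exact: closed_closure.
exists (M + 1); split; first exact: num_real.
move=> M' MM' x cx; apply: le_trans (ltW MM').
have : closure Omega `<=` [set y | `|y| <= M + 1].
  have -> : [set y : 'rV[R]_n | `|y| <= M + 1] = closure [set y : 'rV[R]_n | `|y| <= M + 1].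
    apply/closure_id; rewrite (_ : mkset _ = (fun y => `|y|) @^-1` [set t | t <= M + 1])//.
    by apply: preimage_closed; [move=> y _; exact: norm_continuous | exact: closed_le].
  by apply: closureS => y Oy; apply: bM => //; rewrite ltrDl.
exact.
Qed.

Lemma le_diam Omega x y : bounded_set Omega -> Omega x -> Omega y ->
  enorm (x - y) <= diam Omega.
Proof.
move=> bO Ox Oy; apply: ub_le_sup; last by exists x => //; exists y.
have cO := compact_closure_bounded bO.
have [|M M0 hM] := @compact_bounded_fun (closure Omega) (fun t => enorm (t - x)) cO.
  by apply: continuous_subspaceT; exact: enormB_continuous.
exists (M + M) => _ [a Oa [b Ob <-]]; apply: le_trans (enorm_triangle x _ _) _.
rewrite (enorm_distC x) lerD//; rewrite -[leLHS]ger0_norm ?enorm_ge0//;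
by apply: hM; exact: subset_closure.
Qed.

Lemma enorm_le x (M : 'I_n -> R) : (forall i, `|x 0 i| <= M i) ->
  enorm x <= Num.sqrt (\sum_i M i ^+ 2).
Proof.
move=> h; apply: ler_wsqrtr; apply: ler_sum => i _.
rewrite -expr2 -real_normK ?num_real// ler_pXn2r ?nnegrE//.
exact: le_trans (h i).
Qed.

Lemma lipschitz_continuous (L : R) (f : 'rV[R]_n -> R) : lipschitz_with L f -> continuous f.
Proof.
move=> fL; suff h (x : 'rV[R]_n) : f y @[y --> x] --> f x by exact: h.
apply/(@cvgrPdist_le R R _ (nbhs x) (nbhs_filter x)) => e e0.
have L0 : 0 < `|L| + 1 by rewrite ltr_wpDl.
near=> y; apply: le_trans (fL _ _) _.
have h : enorm (y - x) < e / (`|L| + 1).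
  by near: y; apply: nbhs_enorm; exact: divr_gt0.
rewrite ltr_pdivlMr// in h; rewrite enorm_distC.
apply: le_trans (ltW h); rewrite mulrC ler_wpM2l ?enorm_ge0//.
by apply: le_trans (ler_norm _) _; rewrite lerDl.
Unshelve. all: by end_near. Qed.

Lemma lipschitz_partial (L : R) (f : 'rV[R]_n -> R) i x :
  lipschitz_with L f -> `|partial i f x| <= `|L|.
Proof.
move=> fL; rewrite /partial /derive.
set q := (fun h : R => _).
(* Where the difference quotient has no limit, [partial] takes the default value 0. *)
have [cq|ncq] := pselect (cvg (q @ 0^')); last first.
  by rewrite (dvgP ncq) (_ : point = 0 :> R)// normr0.
have clL : closed [set t : R | `|t| <= `|L|].
  rewrite (_ : mkset _ = (fun y : R => `|y|) @^-1` [set t | t <= `|L|])//.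
  by apply: preimage_closed; [move=> y _; exact: norm_continuous | exact: closed_le].
apply: (@closed_cvg _ _ (0^' : set_system R) _ q _ clL _ _ cq).
near=> h; rewrite /= /q normrZ /= normfV.
have h0 : h != 0 by near: h; exact: nbhs_dnbhs_neq.
rewrite ler_pdivrMl ?normr_gt0//.
have := fL (h *: delta_mx 0 i + x) x; rewrite addrK enormZ.
have -> : enorm (delta_mx 0 i : 'rV[R]_n) = 1.
  by rewrite /enorm inner_delta mxE !eqxx sqrtr1.
rewrite mulr1 => /le_trans; apply; rewrite mulrC ler_wpM2l// ler_norm//.
Unshelve. all: by end_near. Qed.

(** The Lipschitz bound makes both norms finite, so that [fine] is faithful. The bound on [Omega]
    passes to the closure by continuity of f. *)
Lemma le_W1infty Omega (L : R) f : (0 < n)%N -> open Omega -> bounded_set Omega ->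
  lipschitz_with L f ->
  0 <= fine (W1infty Omega f) /\
  forall x, closure Omega x -> `|f x| <= fine (W1infty Omega f).
Proof.
move=> n0 oO bO fL.
have cf := lipschitz_continuous fL.
have cO := compact_closure_bounded bO.
have [M M0 fM] := compact_bounded_fun cO (continuous_subspaceT cf).
have fM' x : Omega x -> `|f x| <= M by move=> /subset_closure/fM.
have gM x : Omega x -> `|enorm (grad f x)| <= Num.sqrt (\sum_(i < n) `|L| ^+ 2).
  move=> _; rewrite ger0_norm ?enorm_ge0//; apply: enorm_le => i.
  by rewrite mxE; exact: lipschitz_partial.
have I1 := Linfty_fin_num n0 M0 fM'.
have I2 := Linfty_fin_num n0 (sqrtr_ge0 _) gM.
rewrite /W1infty fineD//.
have P1 : 0 <= fine (Linfty Omega f) by rewrite fine_ge0// Linfty_ge0.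
have P2 : 0 <= fine (Linfty Omega (fun x => enorm (grad f x))).
  by rewrite fine_ge0// Linfty_ge0.
split; first exact: addr_ge0.
set K := _ + _.
have : closure Omega `<=` [set x | `|f x| <= K].
  have -> : [set x | `|f x| <= K] = closure [set x | `|f x| <= K].
    apply/closure_id; rewrite (_ : mkset _ = (fun y => `|f y|) @^-1` [set t | t <= K])//.
    apply: preimage_closed; last exact: closed_le.
    by move=> y _; apply: continuous_comp; [exact: cf | exact: norm_continuous].
  apply: closureS => x Ox /=.
  apply: (@le_trans _ _ (fine (Linfty Omega f))); last by rewrite lerDl.
  by apply: (fine_Linfty n0 oO _ fM') => // y _; exact: cf.
exact.
Qed.

(** On the compact closure p has a positive minimum and its partial derivatives extend continuously.
    So grad ln p is bounded and continuous in [Omega], and its essential supremum bounds it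
    pointwise. *)
Lemma le_grad_ln Omega p : (0 < n)%N -> open Omega -> bounded_set Omega ->
  C1_closure Omega p -> (forall x, closure Omega x -> 0 < p x) ->
  let E := fine (Linfty Omega (fun x => enorm (grad (fun y => ln (p y)) x))) in
  0 <= E /\ forall x, Omega x -> enorm (grad (fun y => ln (p y)) x) <= E.
Proof.
move=> n0 oO bO [[cp dp] pc pG] p0 E.
have cO := compact_closure_bounded bO.
pose q i x := (p x)^-1 * partial i p x.
have gradE x : Omega x -> grad (fun y => ln (p y)) x = \row_i q i x.
  move=> Ox; apply/rowP => i; rewrite !mxE /partial.
  have px : 0 < p x by apply: p0; exact: subset_closure.
  have H := derivableP ((dp i).1 x Ox).
  by have := is_derive_comp1 H (is_derive1_ln px) => ?; exact: derive_val.
have [m m0 pm] : exists2 m, 0 < m & forall x, Omega x -> m <= p x.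
  have [[x0 Ox0]|O0] := pselect (Omega !=set0); last first.
    by exists 1 => // x Ox; exfalso; apply: O0; exists x.
  have [|x cx hx] := @compact_attains_max _ _ (closure Omega) (fun x => - p x) cO
      (ex_intro _ x0 (subset_closure Ox0)).
    by move=> x; apply: continuousN; exact: pc.
  exists (p x); first exact: p0.
  by move=> y /subset_closure/hx; rewrite lerN2.
have Hq (i : 'I_n) : exists M : R, forall x, Omega x -> `|q i x| <= M.
  have [G Gc Gp] := pG i.
  have [M M0 GM] := compact_bounded_fun cO Gc.
  exists (m^-1 * M) => x Ox; rewrite /q normrM; apply: ler_pM => //.
    rewrite normfV lef_pV2 ?posrE ?normr_gt0 ?gt_eqF//; last first.
      by apply: lt_le_trans (pm x Ox).
    by rewrite gtr0_norm ?pm// (lt_le_trans m0) ?pm.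
  by rewrite -Gp//; apply: GM; exact: subset_closure.
have [M HM] := choice Hq.
pose g x := enorm (\row_i q i x : 'rV[R]_n).
have EE : E = fine (Linfty Omega g).
  by rewrite /E; congr fine; apply: Linfty_ext => x Ox; rewrite gradE.
have gM x : Omega x -> `|g x| <= Num.sqrt (\sum_i M i ^+ 2).
  move=> Ox; rewrite ger0_norm ?enorm_ge0//; apply: enorm_le => i.
  by rewrite mxE; exact: HM.
have cg x : Omega x -> {for x, continuous g}.
  move=> Ox; apply: (@continuous_comp _ _ _
    (fun x => inner (\row_i q i x : 'rV[R]_n) (\row_i q i x)) Num.sqrt).
    rewrite /inner.
    have -> : (fun x => \sum_(i < n)
        (\row_i q i x : 'rV[R]_n) 0 i * (\row_i q i x : 'rV[R]_n) 0 i) =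
        (fun x => \sum_(i < n) q i x * q i x).
      by apply/funext => y; apply: eq_bigr => i _; rewrite !mxE.
    have cq i : {for x, continuous (q i)}.
      apply: continuousM; last by have [_ [h _]] := dp i; exact: h.
      apply: continuousV; last exact: cp.
      by rewrite gt_eqF// p0//; exact: subset_closure.
    apply: (@cvg_big R 'I_n +%R 0 xpredT (@add_continuous R) _ (nbhs x) (index_enum _)
      (fun i x => q i x * q i x)) => i _.
    by apply: continuousM; exact: cq.
  exact: sqrt_continuous.
rewrite EE; split; first by rewrite fine_ge0// Linfty_ge0.
move=> x Ox; rewrite gradE// -[leLHS]ger0_norm ?enorm_ge0//.
exact: (fine_Linfty n0 oO cg gM (sqrtr_ge0 _)).
Qed.

End EssentialSupremum.

(** * The estimate *)

Section Estimate.
Context {R : realType}.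

Lemma powR_fifth (E : R) : 0 <= E -> (E `^ (1 / 5)) ^+ 5 = E.
Proof.
move=> E0; rewrite -powR_mulrn ?powR_ge0// -powRrM.
have -> : 1 / 5 * 5%:R = 1 :> R by field.
by rewrite powRr1.
Qed.

Lemma fifth_root_bound (E M t0 d d1 : R) : 0 <= E -> 0 < M -> 0 < t0 -> t0 <= 1 ->
  0 <= d1 -> d <= d1 ->
  (forall th, 0 < th -> th <= t0 -> E < th ^+ 3 / 34 -> d <= th * M) ->
  d <= d1 / (t0 / 4) ^+ 5 * E + 4 * M * E `^ (1 / 5) * `|ln (expR (- 1) * E)|.
Proof.
move=> E0 M0 t00 t01 d10 dd1 H.
set q := E `^ (1 / 5).
have q0 : 0 <= q by exact: powR_ge0.
have qE : q ^+ 5 = E by exact: powR_fifth.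
have t4 : 0 < t0 / 4 by rewrite divr_gt0.
have T5 : 0 < (t0 / 4) ^+ 5 by rewrite exprn_gt0.
have P1 : 0 <= d1 / (t0 / 4) ^+ 5 * E by rewrite mulr_ge0// divr_ge0// ltW.
have P2 : 0 <= 4 * M * q * `|ln (expR (- 1) * E)| by rewrite !mulr_ge0// ltW.
(* If q > t0 / 4, then E > (t0 / 4)^5 and the linear term alone exceeds [d1]. Otherwise th = 4 q is
   admissible. *)
have [qt|qt] := ltP (t0 / 4) q.
  apply: le_trans dd1 _; rewrite -[leLHS]addr0; apply: lerD => //.
  rewrite -mulrA ler_peMr// ler_pdivlMl// mulr1 -qE.
  by rewrite ler_pXn2r ?nnegrE ?(ltW t4)// ltW.
apply: (@le_trans _ _ (4 * M * q * `|ln (expR (- 1) * E)|)); last by rewrite lerDr.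
(* For E = 0 every th up to [t0] is allowed; letting it tend to 0 gives d <= 0. *)
move: q0; rewrite le_eqVlt => /orP[/eqP q0|q0].
  rewrite -q0 mulr0 mul0r; apply/ler_addgt0Pr => e e0; rewrite add0r.
  have E00 : E = 0 by rewrite -qE -q0 expr0n.
  pose th := Num.min t0 (e / M).
  have th0 : 0 < th by rewrite lt_min t00 divr_gt0.
  apply: (le_trans (H th th0 _ _)).
  - by rewrite ge_min lexx.
  - by rewrite E00 divr_gt0// exprn_gt0.
  - by rewrite -ler_pdivlMr// ge_min lexx orbT.
have q1 : q <= 1 by lra.
have h : d <= 4 * q * M.
  apply: H; [by rewrite mulr_gt0 | lra |].
  rewrite -qE exprMn (_ : q ^+ 5 = q ^+ 3 * q ^+ 2) -?exprD//.
  have q3 : 0 < q ^+ 3 by rewrite exprn_gt0.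
  have : q ^+ 3 * q ^+ 2 <= q ^+ 3 by rewrite ler_piMr ?(ltW q3)// exprn_ile1// ltW.
  lra.
apply: le_trans h _; rewrite (mulrAC 4 q M) ler_peMr ?mulr_ge0 ?(ltW q0) ?(ltW M0)//.
have Ep : 0 < E by rewrite -qE exprn_gt0.
have E1 : E <= 1 by rewrite -qE exprn_ile1// ltW.
(* The constant exp (-1) makes |ln (exp (-1) E)| = 1 - ln E >= 1 for E <= 1, so the factor only
   enlarges the bound. *)
rewrite lnM ?posrE ?expR_gt0// expRK.
have := ln_le0 E1; have := ler_norm (- (-1 + ln E)); rewrite normrN; lra.
Qed.

Context {n : nat}.
Implicit Types (x y z : 'rV[R]_n) (Omega : set 'rV[R]_n) (u v : 'rV[R]_n -> R).

Lemma radial_comparison (E K D th : R) Omega u v :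
  (0 < n)%N -> open Omega -> compact (closure Omega) ->
  (forall x y, Omega x -> Omega y -> enorm (x - y) <= D) ->
  0 <= E -> 0 <= K -> 0 <= D -> 0 < th -> th <= (16 * (K + 1) * (D + 1))^-1 ->
  E < th ^+ 3 / 34 ->
  radial_sub E Omega u -> radial_sub 0 Omega (fun x => - v x) ->
  {within closure Omega, continuous u} -> {within closure Omega, continuous v} ->
  (forall x, closure Omega x -> `|u x| <= K) -> (forall x, closure Omega x -> `|v x| <= K) ->
  (forall x, frontier Omega x -> u x <= v x) ->
  forall x, Omega x -> u x - v x <= th * ((K + 1) ^+ 2 + 2 * (D + 1)).
Proof.
move=> n0 oO cO OD E0 K0 D0 th0 tht Eth usub vsub uc vc uK vK uv x Ox.
have K1 : 1 <= K + 1 by lra.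
have D1 : 1 <= D + 1 by lra.
have KD : 16 * (th * ((K + 1) * (D + 1))) <= 1.
  rewrite -[leRHS](@mulVf _ (16 * (K + 1) * (D + 1))) ?gt_eqF ?mulr_gt0//; [|lra..].
  have -> : 16 * (th * ((K + 1) * (D + 1))) = th * (16 * (K + 1) * (D + 1)) by ring.
  by rewrite ler_pM2r// !mulr_gt0//; lra.
have thK : th * (16 * (K + 1)) <= 1.
  apply: le_trans KD; rewrite (mulrCA th) ler_pM2l// ler_pM2l// ler_peMr//; lra.
have thD : 2 * (th * (D + 1)) <= 1.
  have : th * (D + 1) <= th * ((K + 1) * (D + 1)).
    by rewrite ler_pM2l// ler_peMl//; lra.
  have : 0 <= th * ((K + 1) * (D + 1)) by rewrite !mulr_ge0 ?(ltW th0)//; lra.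
  lra.
apply/ler_addgt0Pr => e e0; have e2 : 0 < e / 2 by rewrite divr_gt0.
have [du du0 hu] := compact_unif_continuous cO uc e2.
have [dv dv0 hv] := compact_unif_continuous cO vc e2.
(* A scale at which both moduli of continuity over distance 3 r are at most e / 2. *)
pose r := Num.min 1 (Num.min (du / 3) (dv / 3)).
have r0 : 0 < r by rewrite !lt_min ltr01 !divr_gt0.
have r1 : r <= 1 by rewrite ge_min lexx.
have ru : 3 * r <= du by rewrite mulrC -ler_pdivlMr// !ge_min lexx !orbT.
have rv : 3 * r <= dv by rewrite mulrC -ler_pdivlMr// !ge_min lexx !orbT.
have := @eps_comparison R n Omega D n0 oO cO OD E K th r (e / 2) u v E0 K0 th0 thK thD Eth
  usub vsub uc vc uK vK r0 r1 _ _ uv x Ox.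
move=> /(_ (fun x y cx cy xy => hu x y cx cy (le_trans xy ru))).
move=> /(_ (fun x y cx cy xy => hv x y cx cy (le_trans xy rv))).
lra.
Qed.

End Estimate.

Theorem theorem1 (R : realType) :
  exists C1 C2 c : R -> R -> R,
    (forall K D : R, [/\ 0 < C1 K D, 0 < C2 K D & 0 < c K D]) /\
    forall (n : nat) (Omega : set 'rV[R]_n) (p f u v : 'rV[R]_n -> R),
      (0 < n)%N ->
      domain Omega -> bounded_set Omega ->
      C1_closure Omega p -> (forall x, closure Omega x -> 0 < p x) ->
      (exists L : R, lipschitz_with L f) ->
      {within closure Omega, continuous u} ->
      viscosity_solution Omega (infx_laplacian p) u ->
      {within closure Omega, continuous v} ->
      viscosity_solution Omega inf_laplacian v ->
      (forall x, frontier Omega x -> u x = f x /\ v x = f x) ->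
      let K := fine (W1infty Omega f) in
      let D := diam Omega in
      let E := fine (Linfty Omega (fun x => enorm (grad (fun y => ln (p y)) x))) in
      (Linfty Omega (fun x => v x - u x)%R <=
        (C1 K D * E + C2 K D * E `^ (1 / 5) * `|ln (c K D * E)|)%:E)%E.
Proof.
(* [t0] is the largest th that [radial_comparison] admits and [M] the factor in its conclusion;
   absolute values keep the constants positive for all real K and D. *)
pose t0 (K D : R) := (16 * (`|K| + 1) * (`|D| + 1))^-1.
pose M (K D : R) := (`|K| + 1) ^+ 2 + 2 * (`|D| + 1).
have K1 (K : R) : 1 <= `|K| + 1 by rewrite lerDr.
have K1' (K : R) : 0 < `|K| + 1 by exact: lt_le_trans (K1 K).
have t00 K D : 0 < t0 K D by rewrite invr_gt0 !mulr_gt0.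
have M0 K D : 0 < M K D by rewrite addr_gt0 ?exprn_gt0 ?mulr_gt0.
exists (fun K D => 2 * (`|K| + 1) / (t0 K D / 4) ^+ 5), (fun K D => 4 * M K D),
  (fun _ _ => expR (- 1)); split.
  move=> K D; split; [|by rewrite mulr_gt0|exact: expR_gt0].
  by rewrite divr_gt0 ?exprn_gt0 ?divr_gt0 ?mulr_gt0.
move=> n Omega p f u v n0 [oO [x0 Ox0] _] bO pC1 p0 [L fL] uc [usup usub] vc [vsup vsub] bc.
lazy zeta; set K := fine (W1infty Omega f); set D := diam Omega; set E := fine _.
have [K0 fK] := le_W1infty n0 oO bO fL; rewrite -/K in K0 fK.
have [E0 pE] := le_grad_ln n0 oO bO pC1 p0; rewrite -/E in E0 pE.
have cO := compact_closure_bounded bO.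
have OD x y : Omega x -> Omega y -> enorm (x - y) <= D by exact: le_diam.
have D0 : 0 <= D by apply: le_trans (OD _ _ Ox0 Ox0); exact: enorm_ge0.
have opu := radial_infx_laplacian pE.
have opv : radial_op 0 Omega inf_laplacian by exact: radial_inf_laplacian.
have u1 := subsolution_radial_sub opu usub.
have u2 := supersolution_radial_sub opu usup.
have v1 := subsolution_radial_sub opv vsub.
have v2 := supersolution_radial_sub opv vsup.
have contN (w : 'rV[R]_n -> R) : {within closure Omega, continuous w} ->
    {within closure Omega, continuous (fun x => - w x)}.
  by move=> wc x; apply: continuousN; exact: wc.
have bound (w : 'rV[R]_n -> R) (e : R) : 0 <= e ->
    {within closure Omega, continuous w} -> radial_sub e Omega w ->
    radial_sub e Omega (fun x => - w x) -> (forall x, frontier Omega x -> w x = f x) ->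
    forall x, closure Omega x -> `|w x| <= K.
  move=> e0 wc w1 w2 wf.
  have wfK x : frontier Omega x -> `|w x| <= K by move=> fx; rewrite wf// fK//; case: fx.
  move=> x cx; have [fx|nfx] := pselect (frontier Omega x); first exact: wfK.
  have Ox := closure_not_frontier cx nfx.
  rewrite ler_norml; apply/andP; split.
    rewrite lerNl; apply: (max_principle n0 e0 cO OD w2 (contN _ wc)) => // y /wfK.
    by rewrite ler_norml => /andP[+ _]; rewrite lerNl.
  apply: (max_principle n0 e0 cO OD w1 wc) => // y /wfK.
  by rewrite ler_norml => /andP[].
have uK := bound u E E0 uc u1 u2 (fun x fx => (bc x fx).1).
have vK := bound v 0 (lexx 0) vc v1 v2 (fun x fx => (bc x fx).2).
have NK (w : 'rV[R]_n -> R) : (forall x, closure Omega x -> `|w x| <= K) ->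
    forall x, closure Omega x -> `|- w x| <= K.
  by move=> h x /h; rewrite normrN.
have t01 : t0 K D <= 1.
  rewrite invf_le1 ?mulr_gt0//.
  have h1 := K1 K; have h2 := K1 D.
  have : 1 * 1 <= (`|K| + 1) * (`|D| + 1) by apply: ler_pM.
  lra.
have v2' : radial_sub 0 Omega (fun x => - - v x).
  by rewrite (_ : (fun x => - - v x) = v)//; apply/funext => x; rewrite opprK.
have H x : Omega x -> `|v x - u x| <= 2 * (`|K| + 1) / (t0 K D / 4) ^+ 5 * E +
    4 * M K D * E `^ (1 / 5) * `|ln (expR (- 1) * E)|.
  move=> Ox; have cx := subset_closure Ox.
  have d1 : `|v x - u x| <= 2 * (`|K| + 1).
    apply: le_trans (ler_normB _ _) _; have := uK x cx; have := vK x cx.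
    rewrite (ger0_norm K0); lra.
  apply: (fifth_root_bound E0 (M0 K D) (t00 K D) t01 _ d1); first by rewrite mulr_ge0// ltW.
  move=> th th0 tht Eth; rewrite /M (ger0_norm K0) (ger0_norm D0).
  rewrite /t0 (ger0_norm K0) (ger0_norm D0) in tht.
  rewrite ler_norml; apply/andP; split.
    rewrite lerNl opprB.
    apply: (radial_comparison n0 oO cO OD E0 K0 D0 th0 tht Eth u1 v2 uc vc uK vK) => //.
    by move=> y /bc[-> ->].
  (* The reverse inequality is the same comparison for the pair -u, -v. *)
  rewrite -[v x]opprK addrC.
  apply: (radial_comparison n0 oO cO OD E0 K0 D0 th0 tht Eth u2 v2' (contN _ uc)
    (contN _ vc) (NK _ uK) (NK _ vK)) => //.
  by move=> y /bc[-> ->].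
apply: Linfty_le => //; exact: le_trans (H x0 Ox0).
Qed.
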